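(* Let $D\subseteq\mathbb{R}$, let $(\Omega,\mathcal{F},P)$ be a probability space, and let $X:D\times\Omega\to\mathbb{R}$ be a centered mean-square continuous stochastic process with $X\in L^2(\Omega\times D)$. There exists a basis $\{e_i\}$ of $L^2(D)$ such that for all $t\in D$, $$X_t=\sum_{i=1}^\infty x_i\,e_i(t)\quad\text{in } L^2(\Omega),$$ where the coefficients $x_i$ are given by $x_i(\omega)=\int_D X_t(\omega)e_i(t)\,dt$ and satisfy the following: 1. $\mathrm{E}[x_i]=0$; 2. $\mathrm{E}[x_ix_j]=\delta_{ij}\lambda_j$; 3. $\mathrm{Var}[x_i]=\lambda_i$. Here $\lambda_i$ denotes the eigenvalue corresponding to $e_i$ of the integral operator $K:L^2(D)\to L^2(D)$, $[Ku](s)=\int_D R_X(s,t)u(t)\,dt$ with $R_X(s,t)=\mathrm{E}[X_sX_t]$; that is, $Ke_i=\lambda_ie_i$.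
   Context: A stochastic process is a map $X:D\times\Omega\to\mathbb{R}$ such that $X_t:=X(t,\cdot)$ is measurable for every $t\in D$. It is centered if $\mathrm{E}[X_t]=0$ for all $t\in D$, and mean-square continuous if $\lim_{\varepsilon\to0}\mathrm{E}[(X_{t+\varepsilon}-X_t)^2]=0$. $R_X$ is called the autocorrelation function of $X$. $\mathrm{E}[\cdot]$ and $\mathrm{Var}[\cdot]$ denote expectation and variance with respect to $P$, $\delta_{ij}$ is the Kronecker delta, and $L^2(\Omega)=L^2(\Omega,\mathcal{F},P)$ is the real Hilbert space of square integrable random variables, with inner product $\mathrm{E}[XY]$. The basis $\{e_i\}$ is a complete orthonormal set of eigenvectors of $K$, and the eigenvalues $\lambda_i$ are real and non-negative.
   Formalization: D is assumed to be a nonempty Borel set such that every neighbourhood of each t in D meets D in positive Lebesgue measure; for arbitrary D the claim fails, e.g. D=[0,1]∪{2} with X_t=ξ·1_{t=2}. *)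

(* Defs.v *)
From HB Require Import structures.
From mathcomp Require Import all_boot all_order all_algebra.
From mathcomp Require Import all_classical all_reals all_analysis.

Set Implicit Arguments.
Unset Strict Implicit.
Unset Printing Implicit Defensive.

Import Order.TTheory GRing.Theory Num.Theory.
Import numFieldNormedType.Exports.

Local Open Scope classical_set_scope.
Local Open Scope ring_scope.

Section L2.
Context (d : measure_display) (T : measurableType d) (R : realType).
Variables (mu : {measure set T -> \bar R}) (A : set T).

(* Elements of L^2(A, mu) are represented by functions on the ambient type;
   only their values on A matter, since f \_ A vanishes outside A. *)
Definition L2 (f : T -> R) : Prop := f \_ A \in Lfun mu 2%:E.

Definition L2_dot (f g : T -> R) : R := \int[mu]_(x in A) (f x * g x).

Definition L2_cvg (u : nat -> T -> R) (f : T -> R) : Prop :=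
  [/\ forall n, L2 (u n), L2 f &
      'N[mu]_2%:E[EFin \o ((u n \- f)%R \_ A)]%E @[n --> \oo] --> 0%E].

Definition orthonormal_basis (e : nat -> T -> R) : Prop :=
  [/\ forall i, L2 (e i),
      forall i j, L2_dot (e i) (e j) = (i == j)%:R &
      forall u, L2 u ->
        L2_cvg (fun n x => \sum_(i < n) L2_dot u (e i) * e i x) u].

(* K u = lam u is an equality in L^2(A, mu), hence almost everywhere on A. *)
Definition eigenvector (K : (T -> R) -> T -> R) (lam : R) (u : T -> R) : Prop :=
  [/\ L2 u,
      ~ {ae mu, forall x, A x -> u x = 0} &
      {ae mu, forall x, A x -> K u x = lam * u x}].

End L2.

Section process.
Context (d : measure_display) (Omega : measurableType d) (R : realType).
Variables (P : probability Omega R) (D : set R) (X : R -> Omega -> R).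

(* X : D x Omega -> R is represented by a function on R x Omega whose values
   at t outside D are irrelevant. *)
Definition stochastic_process : Prop :=
  forall t, D t -> measurable_fun [set: Omega] (X t).

Definition centered : Prop := forall t, D t -> 'E_P[X t]%E = 0%E.

(* The increment eps ranges over those nonzero reals with t + eps in D. *)
Definition mean_square_continuous : Prop :=
  forall t, D t ->
    'E_P[fun w => ((X (t + eps) w - X t w) ^+ 2)%R]%E
      @[eps --> within [set eps | D (t + eps)] (0 : R)^'] --> 0%E.

Definition square_integrable_process : Prop :=
  L2 (P \x (@lebesgue_measure R))%E ([set: Omega] `*` D)
     (fun z => X z.2 z.1).

Definition autocorrelation (s t : R) : R :=
  fine 'E_P[fun w => (X s w * X t w)%R]%E.

Definition autocorrelation_operator (u : R -> R) (s : R) : R :=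
  \int[@lebesgue_measure R]_(t in D) (autocorrelation s t * u t).

Definition process_coef (e : R -> R) (w : Omega) : R :=
  \int[@lebesgue_measure R]_(t in D) (X t w * e t).

End process.

(* Every point of D lies in the support of Lebesgue measure restricted to D. *)
Definition locally_nonnull (R : realType) (D : set R) : Prop :=
  forall t, D t -> forall r : R, 0 < r ->
    (0 < lebesgue_measure (D `&` ball t r))%E.

(* Main.v *)
(* K factors as B^* B, where B u = \int_D X_t u(t) dt maps L^2(D) to L^2(Omega);
   by Tonelli and Parseval, B is Hilbert-Schmidt with squared norm
   T = \int_D E[X_t^2] dt.  Hence K is positive, self-adjoint and trace class.
   A maximal orthonormal set of eigenvectors of K is a basis of L^2(D): on its
   orthogonal complement, if that were nontrivial, the form <Ku, u> would attain
   its supremum at a new eigenvector.  For lam_i > 0 the eigenfunctions are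
   normalised pointwise by e_i(t) = (K e_i)(t) / lam_i, so that
   E[X_t x_i] = lam_i e_i(t) for every t in D, and therefore
     g_n(t) := E[(X_t - \sum_(i < n) x_i e_i(t))^2]
             = E[X_t^2] - \sum_(i < n) lam_i e_i(t)^2.
   Its integral over D is T - \sum_(i < n) lam_i, which tends to 0 because the
   trace of K is T.  Orthogonality of the x_i also gives
   g_n(t) <= 2 g_n(s) + 2 E[(X_t - X_s)^2]; averaging over s in a small ball
   around t and using mean-square continuity yields g_n(t) -> 0 for every t,
   without compactness of D. *)

Require Import Defs.
From HB Require Import structures.
From mathcomp Require Import all_boot all_order all_algebra.
From mathcomp Require Import all_classical all_reals all_analysis.
From mathcomp Require Import measurable_realfun.
From mathcomp Require Import ring lra.

Set Implicit Arguments.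
Unset Strict Implicit.
Unset Printing Implicit Defensive.

Import Order.TTheory GRing.Theory Num.Theory.
Import numFieldNormedType.Exports.

Local Open Scope classical_set_scope.
Local Open Scope ring_scope.

(** * Spectral theorem for compact positive operators *)

(** Vectors of L^2 are kept as functions, not as classes modulo null sets, because e_i and X_t are
    evaluated at points. Inner products are therefore only semi-definite, and an equation between
    vectors is expressed by a vanishing [nsq] of the difference. Compactness of K comes from its
    finite trace, but that trace is summed along a Parseval basis, which must exist beforehand. The
    spectral theorem is therefore applied twice: to the zero operator, where it just produces some
    basis, and then to K. The basis has to be a sequence, so L^2(D) must be shown separable and
    infinite-dimensional. The latter rests on [locally_nonnull], which also gives the averages over
    small balls a positive denominator. *)

Lemma discriminant_le (R : realType) (a b c : R) : 0 <= c ->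
  (forall t, 0 <= a + 2 * t * b + t ^+ 2 * c) -> b ^+ 2 <= a * c.
Proof.
rewrite le_eqVlt => /predU1P[<-|c0] H.
- rewrite mulr0; have [->|b0] := eqVneq b 0; first by rewrite expr0n.
  (* With c = 0 the polynomial is affine in t; at this t its value is -1. *)
  have := H (- (a + 1) / (2 * b)); rewrite mulr0 addr0.
  have -> : a + 2 * (- (a + 1) / (2 * b)) * b = - 1 by field.
  by rewrite lerNr oppr0 ler10.
- have := H (- b / c).
  have -> : a + 2 * (- b / c) * b + (- b / c) ^+ 2 * c = (a * c - b ^+ 2) / c.
    by field; rewrite gt_eqF.
  by rewrite pmulr_lge0 ?invr_gt0// subr_ge0.
Qed.

(** Besides the L^2 product, the form [dot (K u) v] is an instance. Linearity, symmetry and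
    positivity of K are assumed only through it, and Cauchy-Schwarz is used for both forms. *)
Record semi_inner (R : realType) (V : lmodType R) (dot : V -> V -> R) : Prop :=
  SemiInner {
    dotC : forall u v, dot u v = dot v u;
    dotDl : forall u v w, dot (u + v) w = dot u w + dot v w;
    dotZl : forall a u v, dot (a *: u) v = a * dot u v;
    dot_ge0 : forall u, 0 <= dot u u }.

Section semi_inner_theory.
Context (R : realType) (V : lmodType R) (dot : V -> V -> R).
Hypothesis dotP : semi_inner dot.
Local Notation nsq u := (dot u u).

Lemma dotDr u v w : dot w (u + v) = dot w u + dot w v.
Proof. by rewrite (dotC dotP) (dotDl dotP) !(dotC dotP _ w). Qed.

Lemma dotZr a u v : dot u (a *: v) = a * dot u v.
Proof. by rewrite (dotC dotP) (dotZl dotP) (dotC dotP v). Qed.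

Lemma dotNl u v : dot (- u) v = - dot u v.
Proof. by rewrite -scaleN1r (dotZl dotP) mulN1r. Qed.

Lemma dotNr u v : dot u (- v) = - dot u v.
Proof. by rewrite (dotC dotP) dotNl (dotC dotP). Qed.

Lemma dotBl u v w : dot (u - v) w = dot u w - dot v w.
Proof. by rewrite (dotDl dotP) dotNl. Qed.

Lemma dotBr u v w : dot w (u - v) = dot w u - dot w v.
Proof. by rewrite dotDr dotNr. Qed.

Lemma dot0l u : dot 0 u = 0.
Proof. by rewrite -(scale0r 0) (dotZl dotP) mul0r. Qed.

Lemma dot0r u : dot u 0 = 0.
Proof. by rewrite (dotC dotP) dot0l. Qed.

Lemma dot_sumr (I : Type) (r : seq I) (c : I -> R) (e : I -> V) u :
  dot u (\sum_(i <- r) c i *: e i) = \sum_(i <- r) c i * dot u (e i).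
Proof.
elim/big_rec2: _ => [|i x y _ <-]; first exact: dot0r.
by rewrite dotDr dotZr.
Qed.

Lemma nsqZ a u : nsq (a *: u) = a ^+ 2 * nsq u.
Proof. by rewrite (dotZl dotP) dotZr mulrA. Qed.

Lemma nsqN u : nsq (- u) = nsq u.
Proof. by rewrite dotNl dotNr opprK. Qed.

Lemma nsqD u v : nsq (u + v) = nsq u + 2 * dot u v + nsq v.
Proof. by rewrite !(dotDl dotP) !dotDr (dotC dotP v u); ring. Qed.

Lemma nsqB u v : nsq (u - v) = nsq u - 2 * dot u v + nsq v.
Proof. by rewrite nsqD nsqN dotNr; ring. Qed.

Lemma nsqD_le u v : nsq (u + v) <= 2 * nsq u + 2 * nsq v.
Proof.
have := dot_ge0 dotP (u - v); rewrite nsqB nsqD.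
by move=> ?; lra.
Qed.

Lemma cauchy_schwarz u v : dot u v ^+ 2 <= nsq u * nsq v.
Proof.
apply: discriminant_le; first exact: dot_ge0.
move=> t; rewrite -mulrA (mulrC t) -nsqZ -(mulrC t) -dotZr -nsqD.
exact: dot_ge0.
Qed.

Lemma dot_null_l u v : nsq u = 0 -> dot u v = 0.
Proof.
move=> u0; apply/eqP; rewrite -sqrf_eq0 eq_le sqr_ge0 andbT.
by rewrite (le_trans (cauchy_schwarz _ _))// u0 mul0r.
Qed.

Lemma dot_null_eql u v w : nsq (u - v) = 0 -> dot u w = dot v w.
Proof. by move=> /dot_null_l uv; apply/eqP; rewrite -subr_eq0 -dotBl uv. Qed.

(** The weights [lam] serve two families: orthonormal vectors ([lam] = 1) and the coefficients x_i,
    whose squared norms are the eigenvalues. Stating the coordinates as [lam i * c i] avoids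
    dividing by a zero eigenvalue. *)
Lemma pythagoras (I : eqType) (r : seq I) (e : I -> V) (lam c : I -> R) u :
  uniq r ->
  {in r &, forall i j, dot (e i) (e j) = (i == j)%:R * lam j} ->
  {in r, forall i, dot u (e i) = lam i * c i} ->
  nsq (u - \sum_(i <- r) c i *: e i)
    = nsq u - \sum_(i <- r) lam i * c i ^+ 2.
Proof.
elim: r u => [|i r IH] u; first by rewrite !big_nil !subr0.
move=> /= /andP[ir ur] He Hu.
rewrite !big_cons opprD addrA IH//.
- rewrite nsqB dotZr nsqZ Hu ?mem_head// He ?mem_head// eqxx mul1r.
  by rewrite opprD; ring.
- by move=> j k jr kr; apply: He; rewrite inE ?jr ?kr orbT.
- move=> j jr; rewrite dotBl (dotZl dotP) Hu ?inE ?jr ?orbT//.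
  rewrite He ?mem_head ?inE ?jr ?orbT//.
  have -> : (i == j) = false by apply: contraNF ir => /eqP ->.
  by rewrite mul0r mulr0 subr0.
Qed.

Lemma bessel (I : eqType) (r : seq I) (e : I -> V) u : uniq r ->
  {in r &, forall i j, dot (e i) (e j) = (i == j)%:R} ->
  \sum_(i <- r) dot u (e i) ^+ 2 <= nsq u.
Proof.
move=> ur He; have := dot_ge0 dotP (u - \sum_(i <- r) dot u (e i) *: e i).
rewrite (@pythagoras _ _ _ (fun=> 1))//.
- by rewrite subr_ge0; under eq_bigr do rewrite mul1r.
- by move=> i j ir jr; rewrite He ?mulr1.
- by move=> i ir; rewrite mul1r.
Qed.

Definition orthonormal_seq (e : nat -> V) :=
  forall i j, dot (e i) (e j) = (i == j)%:R.

Definition parseval_basis (e : nat -> V) := orthonormal_seq e /\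
  forall u, \sum_(i < n) dot u (e i) ^+ 2 @[n --> \oo] --> nsq u.

Lemma orthonormal_nsqB (e : nat -> V) u n : orthonormal_seq e ->
  nsq (u - \sum_(i < n) dot u (e i) *: e i)
    = nsq u - \sum_(i < n) dot u (e i) ^+ 2.
Proof.
move=> He; rewrite -(big_mkord xpredT (fun i => dot u (e i) *: e i)).
rewrite -(big_mkord xpredT (fun i => dot u (e i) ^+ 2)).
rewrite (@pythagoras _ _ _ (fun=> 1)) ?iota_uniq//.
- by congr (_ - _); apply: eq_bigr => i _; rewrite mul1r.
- by move=> i j _ _; rewrite He mulr1.
- by move=> i _; rewrite mul1r.
Qed.

Lemma parseval_cvg (e : nat -> V) u : parseval_basis e ->
  nsq (\sum_(i < n) dot u (e i) *: e i - u) @[n --> \oo] --> 0.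
Proof.
move=> [He /(_ u) Hu].
have -> : (fun n => nsq (\sum_(i < n) dot u (e i) *: e i - u)) =
    (fun n => nsq u - \sum_(i < n) dot u (e i) ^+ 2).
  by apply/funext => n; rewrite -nsqN opprB orthonormal_nsqB.
suff : nsq u - \sum_(i < n) dot u (e i) ^+ 2 @[n --> \oo] --> nsq u - nsq u.
  by rewrite subrr.
by apply: cvgB => //; exact: cvg_cst.
Qed.

Lemma parseval_basis_null (e f : nat -> V) : parseval_basis e ->
  (forall i, nsq (f i - e i) = 0) -> parseval_basis f.
Proof.
move=> [He Hp] fe.
have fE i u : dot u (f i) = dot u (e i).
  by rewrite !(dotC dotP u); exact: dot_null_eql.
split=> [i j|u]; first by rewrite fE (dotC dotP) fE (dotC dotP) He.
have -> : (fun n => \sum_(i < n) dot u (f i) ^+ 2) =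
    (fun n => \sum_(i < n) dot u (e i) ^+ 2) by
  apply/funext => n; apply: eq_bigr => i _; rewrite fE.
exact: Hp.
Qed.

Lemma dot_cvg0 (u : nat -> V) l v : nsq (u n - l) @[n --> \oo] --> 0 ->
  dot (u n) v @[n --> \oo] --> dot l v.
Proof.
move=> ul; apply/subr_cvg0.
have h : (dot (u n - l) v ^+ 2) @[n --> \oo] --> 0.
  apply: (@squeeze_cvgr _ _ _ _ (cst 0) (fun n => nsq (u n - l) * nsq v)).
  - by apply: nearW => n; rewrite sqr_ge0 cauchy_schwarz.
  - exact: cvg_cst.
  - suff : nsq (u n - l) * nsq v @[n --> \oo] --> 0 * nsq v by rewrite mul0r.
    exact: cvgMl.
have -> : (fun n => dot (u n) v - dot l v) = (fun n => dot (u n - l) v).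
  by apply/funext => n; rewrite dotBl.
apply: norm_cvg0.
have -> : (fun n => `|dot (u n - l) v|) = (fun n => Num.sqrt (dot (u n - l) v ^+ 2)).
  by apply/funext => n; rewrite sqrtr_sqr.
rewrite -(sqrtr0 R); apply: continuous_cvg => //.
exact: sqrt_continuous.
Qed.

Lemma nsq_cvg (u : nat -> V) l : nsq (u n - l) @[n --> \oo] --> 0 ->
  nsq (u n) @[n --> \oo] --> nsq l.
Proof.
move=> ul.
have -> : (fun n => nsq (u n)) =
    (fun n => nsq (u n - l) + (2 * dot (u n) l - nsq l)).
  by apply/funext => n; rewrite nsqB; ring.
suff : nsq (u n - l) + (2 * dot (u n) l - nsq l) @[n --> \oo] -->
    0 + (2 * nsq l - nsq l).
  by rewrite (_ : 0 + (2 * _ - _) = nsq l)//; ring.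
apply: cvgD => //; apply: cvgB; last exact: cvg_cst.
by apply: cvgMr; exact: dot_cvg0.
Qed.

End semi_inner_theory.
Definition dot_complete (R : realType) (V : lmodType R) (dot : V -> V -> R) :=
  forall u : nat -> V,
    (forall e : R, 0 < e -> exists N, forall i j, (N <= i)%N -> (N <= j)%N ->
       dot (u i - u j) (u i - u j) <= e) ->
    exists l, dot (u n - l) (u n - l) @[n --> \oo] --> 0.

(** * Existence of an eigenvector for a compact positive form *)

Section compact_operator.
Context (R : realType) (V : lmodType R) (dot : V -> V -> R) (K : V -> V).
Hypothesis dotP : semi_inner dot.
Hypothesis dot_compl : dot_complete dot.
Local Notation nsq u := (dot u u).
Local Notation q u v := (dot (K u) v).
Hypothesis qP : semi_inner (fun u v => q u v).

Lemma bounded_form_cvg (C : R) (u : nat -> V) l :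
  (forall v, q v v <= C * nsq v) -> nsq (u n - l) @[n --> \oo] --> 0 ->
  q (u n) (u n) @[n --> \oo] --> q l l.
Proof.
move=> HC ul; apply: (nsq_cvg qP).
apply: (@squeeze_cvgr _ _ _ _ (cst 0) (fun n => C * nsq (u n - l))).
- by apply: nearW => n; rewrite HC (dot_ge0 qP).
- exact: cvg_cst.
- suff : C * nsq (u n - l) @[n --> \oo] --> C * 0 by rewrite mulr0.
  exact: cvgMr.
Qed.

(* For the form of a bounded positive operator this is equivalent to
   compactness; it is stable under passing to K-invariant subspaces. *)
Definition compact_form := forall e : R, 0 < e -> exists a : seq V,
  forall u, q u u <= e * nsq u + \sum_(v <- a) dot u v ^+ 2.

Hypothesis qC : compact_form.

Lemma compact_form_bounded : exists2 C : R, 0 <= C & forall u, q u u <= C * nsq u.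
Proof.
have [a Ha] := qC ltr01.
exists (1 + \sum_(v <- a) nsq v).
  by rewrite addr_ge0// sumr_ge0// => v _; exact: dot_ge0.
move=> u; rewrite (le_trans (Ha u))// mulrDl lerD2l mulr_suml.
by apply: ler_sum => v _; rewrite mulrC cauchy_schwarz.
Qed.

(** A closed K-invariant subspace; it will be the orthogonal complement of a maximal orthonormal set
    of eigenvectors. *)
Variable M : set V.
Hypothesis M_lin : forall a u v, M u -> M v -> M (a *: u + v).
Hypothesis M_closed : forall (u : nat -> V) l, (forall n, M (u n)) ->
  nsq (u n - l) @[n --> \oo] --> 0 -> M l.
Hypothesis M_K : forall u, M u -> M (K u).

Let M0 u : M u -> M 0.
Proof. by move=> Mu; rewrite -(subrr u) -scaleN1r addrC; exact: M_lin. Qed.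

Let MZ a u : M u -> M (a *: u).
Proof. by move=> Mu; rewrite -[X in M X]addr0; apply: M_lin => //; exact: M0 Mu. Qed.

Let MB u v : M u -> M v -> M (u - v).
Proof. by move=> Mu Mv; rewrite addrC -scaleN1r; exact: M_lin. Qed.

Let A := [set q u u | u in [set u | M u /\ nsq u <= 1]].
Let m := sup A.

Let A_ub : has_ubound A.
Proof.
have [C C0 HC] := compact_form_bounded.
exists C => _ [u [Mu u1] <-]; rewrite (le_trans (HC u))//.
by rewrite -[leRHS]mulr1 ler_wpM2l.
Qed.

Let q_le_m u : M u -> q u u <= m * nsq u.
Proof.
move=> Mu; have := dot_ge0 dotP u; rewrite le_eqVlt => /predU1P[u0|u0].
  by rewrite -u0 mulr0 (dotC dotP) (dot_null_l dotP).
have : q ((Num.sqrt (nsq u))^-1 *: u) ((Num.sqrt (nsq u))^-1 *: u) <= m.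
  apply: (ub_le_sup A_ub); exists ((Num.sqrt (nsq u))^-1 *: u) => //.
  split; first exact: MZ.
  by rewrite (nsqZ dotP) exprVn sqr_sqrtr ?mulVf ?gt_eqF// ltW.
by rewrite (nsqZ qP) exprVn (sqr_sqrtr (ltW u0)) mulrC ler_pdivrMr.
Qed.

(** A maximising sequence can be chosen Cauchy. By compactness q is at most m / 2 * nsq up to
    finitely many coordinates, and the coordinate vectors have a cluster point p, near which the
    sequence is picked. On differences the defect m * nsq - q is small, so m / 2 * nsq is bounded by
    small terms. *)
Let maximizer : 0 < m -> (exists u, M u) ->
  exists u, [/\ M u, nsq u <= 1 & q u u = m].
Proof.
move=> m0 [u0 Mu0].
have [a Ha] : exists a : seq V, forall u,
    q u u <= m / 2 * nsq u + \sum_(v <- a) dot u v ^+ 2.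
  by apply: qC; rewrite divr_gt0.
have supA : has_sup A.
  split=> //; exists (q 0 0); exists 0 => //; split; first exact: M0 Mu0.
  by rewrite dot0l.
have /choice[u Hu] : forall n : nat, exists u,
    [/\ M u, nsq u <= 1 & m - (n.+1%:R^-1 : R) < q u u].
  move=> n; have [|_ [u [Mu u1] <-] h] := @sup_adherent _ A n.+1%:R^-1 _ supA.
    by rewrite invr_gt0.
  by exists u.
pose N := size a.
pose Phi (u : V) : 'rV[R]_N := \row_i dot u a`_i.
have cK : compact [set v : 'rV[R]_N |
    forall i : 'I_N, `[- (1 + nsq a`_i), 1 + nsq a`_i]%classic (v ord0 i)].
  apply: (@rV_compact R N
    (fun i => `[- (1 + nsq a`_i), 1 + nsq a`_i]%classic)) => i.
  exact: segment_compact.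
have FK : (Phi (u n) @[n --> \oo]) [set v : 'rV[R]_N |
    forall i : 'I_N, `[- (1 + nsq a`_i), 1 + nsq a`_i]%classic (v ord0 i)].
  exists 0%N => // n _ i /=; rewrite mxE in_itv/= -ler_norml.
  have [_ un1 _] := Hu n.
  have := cauchy_schwarz dotP (u n) a`_i.
  rewrite -real_normK ?num_real//.
  have := dot_ge0 dotP a`_i; have := dot_ge0 dotP (u n).
  have := normr_ge0 (dot (u n) a`_i).
  by move: `|_| (nsq (u n)) (nsq _) un1 => x y z; nra.
have [p [_ cp]] := cK _ _ FK.
have /choice[w Hw] : forall j : nat, exists w, [/\ M w, nsq w <= 1,
    m - (j.+1%:R^-1 : R) < q w w &
    forall i : 'I_N, `|p ord0 i - dot w a`_i| < (j.+1%:R^-1 : R)].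
  move=> j.
  have Fj : (Phi (u n) @[n --> \oo]) [set Phi (u n) | n in [set n | (j <= n)%N]].
    by exists j => // n /= jn; exists n.
  have Bj : nbhs p (ball p (j.+1%:R^-1 : R)) by exact: nbhsx_ballx.
  have [_ [[n /= jn <-] pn]] := cp _ _ Fj Bj.
  have [Mun un1 qn] := Hu n.
  exists (u n); split => //.
    by rewrite (le_lt_trans _ qn)// lerD2l lerN2 lef_pV2 ?posrE// ler_nat.
  by move=> i; have := pn.2 ord0 i; rewrite mxE.
have [l wl] : exists l, nsq (w n - l) @[n --> \oo] --> 0.
  apply: dot_compl => e e0.
  (* The estimates [BB] and [SS] below give m / 2 * nsq (w i - w j) <= 4 * d + N * 4 * d, that is
     nsq (w i - w j) <= C * d. *)
  pose C : R := 2 / m * (4 + N%:R * 4).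
  have C0 : 0 < C by rewrite mulr_gt0 ?divr_gt0// ltr_pwDl// mulr_ge0.
  exists (Num.truncn (C / e)) => i j Ni Nj.
  pose d := (Num.truncn (C / e)).+1%:R^-1 : R.
  have d0 : 0 < d by rewrite invr_gt0.
  have d1 : d <= 1 by rewrite invf_le1// ler1n.
  have Cd : C * d <= e.
    by rewrite ler_pdivrMr// -ler_pdivrMl// mulrC ltW// truncnS_gt.
  have dle k : (Num.truncn (C / e) <= k)%N -> (k.+1%:R^-1 : R) <= d.
    by move=> ?; rewrite lef_pV2 ?posrE// ler_nat ltnS.
  clearbody d.
  have Bw k : (Num.truncn (C / e) <= k)%N -> m * nsq (w k) - q (w k) (w k) <= d.
    move=> Nk; have [_ w1 qw _] := Hw k; have := dle _ Nk.
    have : m * nsq (w k) <= m by rewrite -[leRHS]mulr1 ler_pM2l.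
    by move: qw; generalize m (k.+1%:R^-1 : R) => m' x; lra.
  have [Mi _ _ pi] := Hw i; have [Mj _ _ pj] := Hw j.
  (* Parallelogram law for the form m * nsq - q: it is nonnegative at w i + w j, so at w i - w j it
     is at most twice the sum of its values at w i and w j. *)
  have BB : m * nsq (w i - w j) - q (w i - w j) (w i - w j) <= 4 * d.
    have := q_le_m (M_lin 1 Mi Mj); rewrite scale1r.
    rewrite (nsqB dotP) (nsqB qP) (nsqD dotP) (nsqD qP) /=.
    by move: (Bw _ Ni) (Bw _ Nj); generalize m => m'; lra.
  have SS : \sum_(v <- a) dot (w i - w j) v ^+ 2 <= N%:R * 4 * d.
    rewrite (big_nth 0) big_mkord.
    have -> : N%:R * 4 * d = \sum_(k < size a) 4 * d.
      by rewrite sumr_const card_ord -[RHS]mulr_natl mulrA.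
    apply: ler_sum => k _.
    have : `|dot (w i - w j) a`_k| <= 2 * d.
      have -> : dot (w i - w j) a`_k =
        (p ord0 k - dot (w j) a`_k) - (p ord0 k - dot (w i) a`_k).
        by rewrite (dotBl dotP); ring.
      rewrite (le_trans (ler_normB _ _))//.
      have := ltW (pi k); have := ltW (pj k).
      by move: (dle _ Ni) (dle _ Nj);
        generalize (i.+1%:R^-1 : R) (j.+1%:R^-1 : R) => x y; lra.
    rewrite -real_normK ?num_real//; have := normr_ge0 (dot (w i - w j) a`_k).
    by move: `|_| => x; nra.
  have h : m * nsq (w i - w j) <= 2 * ((4 + N%:R * 4) * d).
    move: (Ha (w i - w j)) BB SS; set S := \sum_(_ <- _) _; clearbody S.
    rewrite mulrAC [(4 + _) * d]mulrDl; move: (m * nsq (w i - w j)) => z.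
    by move: (N%:R * 4 * d) => y; lra.
  rewrite (le_trans _ Cd)//.
  have -> : C * d = 2 * ((4 + N%:R * 4) * d) / m.
    by rewrite /C; field; rewrite gt_eqF.
  by rewrite ler_pdivlMr// mulrC.
have Ml : M l by apply: M_closed wl => n; have [] := Hw n.
exists l; split => //.
  apply: (ler_cvg_to (nsq_cvg dotP wl) (cvg_cst _)).
  by apply: nearW => n; have [] := Hw n.
have [C _ HC] := compact_form_bounded.
apply: (cvg_unique _ (bounded_form_cvg HC wl)) => //.
apply: (@squeeze_cvgr _ _ _ _ (fun n => m - n.+1%:R^-1) (cst m)).
- apply: nearW => n; have [Mw w1 /ltW -> _] := Hw n => /=.
  by rewrite (le_trans (q_le_m Mw))// -[leRHS]mulr1 ler_pM2l.
- suff : m - n.+1%:R^-1 @[n --> \oo] --> m - 0 by rewrite subr0.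
  apply: cvgB; first exact: cvg_cst.
  exact: cvg_harmonic.
- exact: cvg_cst.
Qed.

Lemma compact_eigenvector u0 : M u0 -> nsq u0 != 0 ->
  exists u lam, [/\ M u, nsq u = 1, 0 <= lam & nsq (K u - lam *: u) = 0].
Proof.
move=> Mu0 u0N.
(* Testing the eigenvalue equation against M suffices, since K u - lam *: u itself lies in M. *)
have normalize u lam : M u -> nsq u != 0 -> 0 <= lam ->
    (forall v, M v -> dot (K u - lam *: u) v = 0) ->
    exists u lam, [/\ M u, nsq u = 1, 0 <= lam & nsq (K u - lam *: u) = 0].
  move=> Mu uN lam0 H; pose c := (Num.sqrt (nsq u))^-1.
  have nu0 : 0 <= nsq u by exact: dot_ge0.
  exists (c *: u), lam; split => //; first exact: MZ.
    by rewrite (nsqZ dotP) exprVn sqr_sqrtr// mulVf.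
  have Hc v : M v -> dot (K (c *: u) - lam *: (c *: u)) v = 0.
    move=> Mv; have := H v Mv.
    rewrite !(dotBl dotP) (dotZl qP c u v) !(dotZl dotP) => /eqP.
    by rewrite subr_eq0 => /eqP ->; ring.
  by apply: Hc; apply: MB; [apply: M_K|do 2 apply: MZ] => //; exact: MZ.
(* If m <= 0 then q u0 u0 = 0, and Cauchy-Schwarz for q makes K u0 orthogonal to everything: u0 is
   an eigenvector for 0. *)
have [m0|m0] := ltP 0 m; last first.
  apply: (normalize u0 0) => // v Mv; rewrite scale0r subr0.
  apply: (dot_null_l qP); apply/eqP; rewrite eq_le (dot_ge0 qP) andbT.
  by rewrite (le_trans (q_le_m Mu0))// mulr_le0_ge0// dot_ge0.
have [u [Mu u1 qu]] := maximizer m0 (ex_intro _ _ Mu0).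
have u1' : nsq u = 1.
  apply/eqP; rewrite eq_le u1/=.
  by have := q_le_m Mu; rewrite qu -{1}[m]mulr1 ler_pM2l.
apply: (normalize u m) => //; [by rewrite u1' oner_neq0|exact: ltW|].
move=> v Mv.
(* [m * nsq - q] is nonnegative on M and vanishes at [u], hence so does its
   polar form [dot (m *: u - K u)]. *)
have : (m * dot u v - q u v) ^+ 2 <= 0 * (m * nsq v - q v v).
  apply: discriminant_le; first by rewrite subr_ge0 q_le_m.
  move=> t.
  have := q_le_m (M_lin t Mv Mu); rewrite addrC.
  rewrite (nsqD dotP) (nsqD qP) (nsqZ dotP) (nsqZ qP) !(dotZr dotP).
  rewrite u1' qu.
  by rewrite -subr_ge0; congr (0 <= _); ring.
rewrite mul0r => h; have := sqr_ge0 (m * dot u v - q u v).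
move=> h'; have /eqP : (m * dot u v - q u v) ^+ 2 = 0 by apply/eqP; rewrite eq_le h.
rewrite sqrf_eq0 => /eqP h''.
by rewrite (dotBl dotP) (dotZl dotP) -opprB h'' oppr0.
Qed.

End compact_operator.

(** * Countability, cardinality and totality of orthonormal sets *)

Section orthonormal_sets.
Context (R : realType) (V : lmodType R) (dot : V -> V -> R).
Hypothesis dotP : semi_inner dot.
Local Notation nsq u := (dot u u).

Definition orthonormal_set (S : set V) :=
  forall u v, S u -> S v -> dot u v = (u == v)%:R.

(* A countable family replaces a countable dense subset: a vector has at most
   countably many nonzero coordinates in an orthonormal set. *)
Definition countably_total :=
  exists g : nat -> V, forall u, (forall k, dot u (g k) = 0) -> nsq u = 0.

Definition infinite_dim := forall n, exists g : nat -> V,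
  forall i j, (i < n)%N -> (j < n)%N -> dot (g i) (g j) = (i == j)%:R.

Lemma orthonormal_set_countable (S : set V) : countably_total ->
  orthonormal_set S -> countable S.
Proof.
move=> [g gtot] onS.
(* By Bessel, B k n has at most (n + 1) * nsq (g k) elements. Each u in S has norm 1, so it is not
   orthogonal to every g k and lies in some B k n. *)
pose B k n := [set u | S u /\ (n.+1%:R^-1 : R) < dot (g k) u ^+ 2].
apply: (@sub_countable _ _ _ (\bigcup_k \bigcup_n B k n)).
  apply: subset_card_le => u Su.
  have : exists k, dot u (g k) != 0.
    apply: contrapT => H; have : nsq u = 0.
      apply: gtot => k; apply/eqP; apply: contrapT => /negP uk.
      by apply: H; exists k.
    by rewrite onS// eqxx => /eqP; rewrite oner_eq0.
  move=> [k uk]; exists k => //; have uk0 : 0 < dot (g k) u ^+ 2.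
    by rewrite lt_neqAle eq_sym sqrf_eq0 (dotC dotP) uk sqr_ge0.
  exists (Num.truncn (dot (g k) u ^+ 2)^-1) => //; split => //.
  by rewrite invf_plt ?posrE// truncnS_gt.
apply: bigcup_countable => // k _; apply: bigcup_countable => // n _.
apply: finite_set_countable; apply: contrapT => inf.
have [X XB] := infinite_set_fset (Num.truncn (n.+1%:R * nsq (g k))).+1 inf.
apply/negP; rewrite -ltnNge -(ltr_nat R).
apply: (@le_lt_trans _ _ (n.+1%:R * nsq (g k))); last exact: truncnS_gt.
rewrite -ler_pdivrMl//.
apply: (@le_trans _ _ (\sum_(u <- finmap.enum_fset X) dot (g k) u ^+ 2)).
  have -> : n.+1%:R^-1 * (size (finmap.enum_fset X))%:R =
      \sum_(u <- finmap.enum_fset X) (n.+1%:R^-1 : R).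
    by rewrite big_const_seq count_predT iter_addr_0 mulr_natr.
  rewrite big_seq [leRHS]big_seq; apply: ler_sum => u uX.
  by have [] := XB _ uX => _ /ltW.
apply: (bessel dotP (e := id)) => [|u v uX vX /=]; first exact: finmap.fset_uniq.
by apply: onS; [have [] := XB _ uX|have [] := XB _ vX].
Qed.

Definition total_set (S : set V) :=
  forall u, (forall v, S v -> dot u v = 0) -> nsq u = 0.

(** Double counting. If S had n elements, take n + 1 orthonormal vectors g i and sum the squares of
    all dot (g i) v: totality gives 1 for each g i, hence n + 1, while Bessel gives at most 1 for
    each v, hence at most n. *)
Lemma total_orthonormal_infinite (S : set V) : infinite_dim ->
  orthonormal_set S -> total_set S -> ~ finite_set S.
Proof.
move=> infV onS totS /finite_fsetP[X SX].
pose r := finmap.enum_fset X; pose n := size r.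
have ur : uniq r by exact: finmap.fset_uniq.
have onr : {in r &, forall u v, dot u v = (u == v)%:R}.
  by move=> u v ur' vr'; apply: onS; rewrite SX.
have [g gon] := infV n.+1.
have gS i : (i < n.+1)%N -> \sum_(v <- r) dot (g i) v ^+ 2 = 1.
  move=> iN; pose w := g i - \sum_(v <- r) dot (g i) v *: v.
  have pyth : nsq w = nsq (g i) - \sum_(v <- r) 1 * dot (g i) v ^+ 2.
    apply: (@pythagoras _ _ _ dotP _ _ id (fun=> 1)) => //.
    - by move=> u v ur' vr'; rewrite onr ?mulr1.
    - by move=> v _; rewrite mul1r.
  have w0 : nsq w = 0.
    apply: totS => v; rewrite SX => vr.
    rewrite (dotC dotP) (dotBr dotP) (@dot_sumr _ _ _ dotP _ _ _ id).
    rewrite (bigD1_seq v)//= (onr v v vr vr) eqxx mulr1 big_seq_cond big1; last first.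
      by move=> u /andP[ur' uv]; rewrite (onr v u)// eq_sym (negPf uv) mulr0.
    by rewrite addr0 (dotC dotP) subrr.
  move: pyth; rewrite w0 gon// eqxx => /esym/eqP.
  rewrite subr_eq0 => /eqP; rewrite -[LHS]/(1 : R) => ->.
  by apply: eq_bigr => v _; rewrite mul1r.
have : (n.+1%:R : R) <= n%:R.
  have -> : (n.+1%:R : R) = \sum_(i < n.+1) \sum_(v <- r) dot (g i) v ^+ 2.
    rewrite (eq_bigr (fun=> 1)) => [|i _]; last by rewrite gS.
    by rewrite sumr_const card_ord.
  rewrite exchange_big/=.
  have -> : (n%:R : R) = \sum_(v <- r) 1.
    by rewrite big_const_seq count_predT iter_addr_0.
  rewrite big_seq [leRHS]big_seq; apply: ler_sum => v vr.
  have -> : 1 = nsq v by rewrite onr// eqxx.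
  rewrite -(big_mkord xpredT (fun i => dot (g i) v ^+ 2)).
  under eq_bigr do rewrite (dotC dotP).
  apply: (bessel dotP) => [|i j]; first exact: iota_uniq.
  by rewrite !mem_index_iota => iN jN; exact: gon.
by rewrite ler_nat ltnn.
Qed.

Lemma monotone_bounded_cauchy (a : nat -> R) (C : R) :
  {homo a : n m / (n <= m)%N >-> n <= m} -> (forall n, a n <= C) ->
  forall e : R, 0 < e -> exists N, forall n, (N <= n)%N -> a n - a N <= e.
Proof.
move=> nda aC e e0.
have acvg : a n @[n --> \oo] --> sup (range a).
  by apply: nondecreasing_cvgn => //; exists C => _ [n _ <-].
have /cvgrPdist_le/(_ _ e0)[N _ HN] := acvg.
exists N => n Nn.
have : a n <= sup (range a).
  by apply: ub_le_sup; [exists C => _ [k _ <-]|exists n].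
have := HN N (leqnn N) => /=; rewrite ler_norml => /andP[_].
by move: (sup _) => s; lra.
Qed.

Lemma dot_orthonormal_sum (e : nat -> V) (c : nat -> R) n k :
  orthonormal_seq dot e -> (k < n)%N -> dot (\sum_(i < n) c i *: e i) (e k) = c k.
Proof.
move=> one kn; rewrite (dotC dotP).
rewrite (dot_sumr dotP) (bigD1 (Ordinal kn))//= one eqxx mulr1 big1 ?addr0//.
move=> i ik; rewrite one.
have -> : (k == i) = false by apply: contraNF ik => /eqP ki; apply/eqP/val_inj.
by rewrite mulr0.
Qed.

Lemma nsq_orthonormal_sumB (e : nat -> V) (c : nat -> R) n m :
  orthonormal_seq dot e -> (m <= n)%N ->
  nsq (\sum_(i < n) c i *: e i - \sum_(i < m) c i *: e i)
    = \sum_(i < n) c i ^+ 2 - \sum_(i < m) c i ^+ 2.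
Proof.
move=> one mn.
have H k l : (k <= l)%N ->
    dot (\sum_(i < l) c i *: e i) (\sum_(i < k) c i *: e i)
      = \sum_(i < k) c i ^+ 2.
  move=> kl; rewrite (dot_sumr dotP); apply: eq_bigr => i _.
  by rewrite dot_orthonormal_sum// (leq_trans _ kl).
by rewrite (nsqB dotP) !H//; ring.
Qed.

(** By Bessel the partial expansions are Cauchy. Their limit has the same coordinates as u, so by
    totality it differs from u by a null vector. *)
Lemma total_orthonormal_parseval (e : nat -> V) : dot_complete dot ->
  orthonormal_seq dot e -> (forall u, (forall i, dot u (e i) = 0) -> nsq u = 0) ->
  parseval_basis dot e.
Proof.
move=> compl one tot; split=> // u.
pose a n := \sum_(i < n) dot u (e i) ^+ 2.
pose s n := \sum_(i < n) dot u (e i) *: e i.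
have nda : {homo a : n m / (n <= m)%N >-> n <= m}.
  apply/nondecreasing_seqP => n.
  by rewrite /a big_ord_recr/= lerDl sqr_ge0.
have aC n : a n <= nsq u.
  rewrite -subr_ge0 -(orthonormal_nsqB dotP)//; exact: dot_ge0.
have [l sl] : exists l, nsq (s n - l) @[n --> \oo] --> 0.
  apply: compl => eps eps0.
  have [N HN] := monotone_bounded_cauchy nda aC eps0.
  have HH i j : (N <= j)%N -> (j <= i)%N -> nsq (s i - s j) <= eps.
    move=> Nj ji; rewrite (@nsq_orthonormal_sumB e (fun k => dot u (e k)))//.
    rewrite (le_trans _ (HN _ (leq_trans Nj ji)))// lerD2l lerN2.
    exact: nda.
  exists N => i j Ni Nj; have [ij|ji] := leqP i j; last exact/HH/ltnW.
  by rewrite -(nsqN dotP) opprB HH.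
have dotl i : dot l (e i) = dot u (e i).
  apply: (cvg_unique _ (dot_cvg0 (v := e i) dotP sl)) => //.
  apply: cvg_near_cst; exists i.+1 => // n /= ni.
  exact: (@dot_orthonormal_sum e (fun i => dot u (e i))).
have ul : nsq (u - l) = 0.
  by apply: tot => i; rewrite (dotBl dotP) dotl subrr.
have lu : nsq l = nsq u.
  by rewrite -(dot_null_eql dotP _ ul) (dotC dotP) -(dot_null_eql dotP _ ul).
have aE : a = fun n => nsq (s n).
  apply/funext => n; have := @nsq_orthonormal_sumB e (fun i => dot u (e i)) n 0 one.
  by rewrite !big_ord0 !subr0 => ->.
by rewrite -/a aE -lu; exact: nsq_cvg.
Qed.

End orthonormal_sets.

Section spectral_theorem.
Context (R : realType) (V : lmodType R) (dot : V -> V -> R).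
Hypothesis dotP : semi_inner dot.
Hypothesis dot_compl : dot_complete dot.
Hypothesis dot_sep : countably_total dot.
Hypothesis dot_inf : infinite_dim dot.
Local Notation nsq u := (dot u u).

Theorem compact_eigenbasis (K : V -> V) :
  semi_inner (fun u v => dot (K u) v) -> compact_form dot K ->
  exists (e : nat -> V) (lam : nat -> R), [/\ parseval_basis dot e,
    forall i, 0 <= lam i & forall i, nsq (K (e i) - lam i *: e i) = 0].
Proof.
move=> qP qC.
(* The eigenvalue stays existential, so that unions of chains remain admissible for Zorn's lemma;
   the sequence [lam] is chosen once S has been enumerated. *)
pose Ev := [set u | exists2 lam, 0 <= lam & nsq (K u - lam *: u) = 0].
have [S [[SE onS] Smax]] : exists S : set V,
    (S `<=` Ev /\ orthonormal_set dot S) /\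
    forall B, S `<` B -> ~ (B `<=` Ev /\ orthonormal_set dot B).
  apply: (@Zorn_bigcup _ [set S | S `<=` Ev /\ orthonormal_set dot S]).
  move=> F FP Ftot; split; first by move=> u [X /FP[XE _] /XE].
  move=> u v [X FX Xu] [Y FY Yv].
  have [XY|YX] := Ftot _ _ FX FY.
    by have [_] := FP _ FY; apply => //; exact: XY.
  by have [_] := FP _ FX; apply => //; exact: YX.
have totS : total_set dot S.
  move=> u0 u0S; apply: contrapT => /eqP u0N.
  have [|||u [lam [Mu u1 lam0 uE]]] := @compact_eigenvector _ _ _ K dotP
    dot_compl qP qC [set u | forall v, S v -> dot u v = 0] _ _ _ u0 u0S u0N.
  - move=> a u v Mu Mv w Sw.
    by rewrite (dotDl dotP) (dotZl dotP) Mu// Mv// mulr0 addr0.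
  - move=> u l Mu ul v Sv; apply: (cvg_unique _ (dot_cvg0 (v := v) dotP ul)) => //.
    by apply: cvg_near_cst; apply: nearW => n; exact: Mu.
  - move=> u Mu v Sv; rewrite (dotC qP).
    have [lam _ /(dot_null_eql dotP) ->] := SE _ Sv.
    by rewrite (dotZl dotP) (dotC dotP) Mu// mulr0.
  have uNS : ~ S u by move=> /Mu; rewrite u1 => /eqP; rewrite oner_eq0.
  apply: (Smax (S `|` [set u])).
    split; last by move=> /(_ u) H; apply: uNS; apply: H; right.
    by move=> v Sv; left.
  split=> [v [/SE//|->]|v w]; first by exists lam.
  move=> [Sv|->] [Sw|->].
  - exact: onS.
  - rewrite (dotC dotP) Mu//; case: eqP => // vu; by rewrite -vu in uNS.
  - rewrite Mu//; case: eqP => // uw; by rewrite uw in uNS.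
  - by rewrite eqxx.
have cS : countable S by exact: (orthonormal_set_countable dotP).
have iS : ~ finite_set S by exact: (total_orthonormal_infinite dotP dot_inf onS).
have /card_set_bijP[f [_ finj fsurj]] : (S #= [set: nat])%card.
  by rewrite card_eq_le; apply/andP; split => //; exact/infiniteP.
have /choice[e He] : forall n : nat, exists u, S u /\ f u = n.
  by move=> n; have [u Su fu] := fsurj n I; exists u.
have one : orthonormal_seq dot e.
  move=> i j; have [Si fi] := He i; have [Sj fj] := He j.
  rewrite onS//; case: (eqVneq i j) => [->|ij]; first by rewrite eqxx.
  by case: eqP => // eij; rewrite -fi -fj eij eqxx in ij.
have /choice[lam Hlam] : forall i, exists lam : R,
    0 <= lam /\ nsq (K (e i) - lam *: e i) = 0.
  by move=> i; have [/SE[lam l0 lE] _] := He i; exists lam.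
exists e, lam; split=> [|i|i].
2-3: by have [] := Hlam i.
apply: total_orthonormal_parseval => // u ue; apply: totS => v Sv.
have [Se fe] := He (f v).
suff <- : e (f v) = v by exact: ue.
by apply: finj; rewrite ?inE.
Qed.

Corollary parseval_basis_exists : exists e, parseval_basis dot e.
Proof.
have [||e [_ [He _ _]]] := @compact_eigenbasis (fun=> 0); last by exists e.
- split=> *; rewrite ?(dot0l dotP) ?addr0 ?mulr0//.
- move=> eps eps0; exists [::] => u; rewrite big_nil addr0 (dot0l dotP).
  by rewrite mulr_ge0 ?(ltW eps0)// dot_ge0.
Qed.

End spectral_theorem.

(** * Finite trace implies compactness *)

Section trace_class.
Context (R : realType) (V : lmodType R) (dot : V -> V -> R) (K : V -> V).
Hypothesis dotP : semi_inner dot.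
Local Notation nsq u := (dot u u).
Local Notation q u v := (dot (K u) v).
Hypothesis qP : semi_inner (fun u v => q u v).

(** The triangle inequality for the seminorm of q followed by Cauchy-Schwarz for finite sums. The
    induction avoids square roots; its cross term is controlled by the arithmetic-geometric mean
    inequality in [h2]. *)
Let qsum (r : seq nat) (c : nat -> R) (f : nat -> V) :
  q (\sum_(k <- r) c k *: f k) (\sum_(k <- r) c k *: f k) <=
  (\sum_(k <- r) c k ^+ 2) * \sum_(k <- r) q (f k) (f k).
Proof.
elim: r => [|k r IH]; first by rewrite !big_nil (dot0r dotP) mulr0.
rewrite !big_cons (nsqD qP) (nsqZ qP) (dotZl qP).
set y := \sum_(j <- r) c j *: f j in IH *.
set A := \sum_(j <- r) c j ^+ 2 in IH *.
set B := \sum_(j <- r) q (f j) (f j) in IH *.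
have A0 : 0 <= A by apply: sumr_ge0 => i _; exact: sqr_ge0.
have B0 : 0 <= B by apply: sumr_ge0 => i _; exact: (dot_ge0 qP).
have F0 := dot_ge0 qP (f k).
have CS := cauchy_schwarz qP (f k) y.
rewrite /= in F0 CS IH *; move: (c k) => x.
move: (q (f k) y) (q (f k) (f k)) (q y y) F0 CS IH => z F Y F0 CS IH.
have h1 : z ^+ 2 <= F * (A * B) by rewrite (le_trans CS)// ler_wpM2l.
have h2 : 2 * (x * z) <= x ^+ 2 * B + A * F.
  have b0 : 0 <= x ^+ 2 * B by rewrite mulr_ge0// sqr_ge0.
  have d0 : 0 <= A * F by rewrite mulr_ge0.
  have h3 : (x * z) ^+ 2 <= x ^+ 2 * B * (A * F).
    rewrite exprMn.
    rewrite (_ : x ^+ 2 * B * (A * F) = x ^+ 2 * (F * (A * B))); last by ring.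
    by rewrite ler_wpM2l// sqr_ge0.
  rewrite leNgt; apply/negP; move: b0 d0 h3.
  move: (x * z) (x ^+ 2 * B) (A * F) => a b d b0 d0 h3 h.
  have : 0 < (2 * a - (b + d)) * (2 * a + (b + d)) by rewrite mulr_gt0//; lra.
  by have := sqr_ge0 (b - d); nra.
rewrite [leRHS]mulrDr ![(_ + A) * _]mulrDl; move: h2 IH.
by move: (x * z) (x ^+ 2 * B) (A * F) (A * B) (x ^+ 2 * F) => *; lra.
Qed.

(** Split u into its first N coordinates and a remainder. [qsum] bounds q of the remainder by nsq u
    times the tail of the trace, and q of the head by finitely many squared coordinates. *)
Lemma trace_class_compact_form (f : nat -> V) (C T : R) :
  parseval_basis dot f -> (forall u, q u u <= C * nsq u) ->
  (forall n, \sum_(k < n) q (f k) (f k) <= T) -> compact_form dot K.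
Proof.
move=> fB qb qT eps eps0.
pose t n := \sum_(k < n) q (f k) (f k).
have ndt : {homo t : n m / (n <= m)%N >-> n <= m}.
  apply/nondecreasing_seqP => n.
  by rewrite /t big_ord_recr/= lerDl (dot_ge0 qP).
have t0 n : 0 <= t n by apply: sumr_ge0 => i _; exact: (dot_ge0 qP).
have [N HN] := monotone_bounded_cauchy ndt qT (divr_gt0 eps0 (ltr0n R 2)).
(* The scaling turns the sum of squares into 2 * t N times that of the first N coordinates. The
   factor 2, like the eps / 2 for the tail, pays for q (x + y) <= 2 q x + 2 q y. *)
exists [seq Num.sqrt (2 * t N) *: f k | k <- index_iota 0 N] => u.
pose c k := dot u (f k).
pose s n := \sum_(k < n) c k *: f k.
have sE n : s n = \sum_(0 <= k < n) c k *: f k by rewrite big_mkord.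
have qP1 : q (s N) (s N) <= (\sum_(0 <= k < N) c k ^+ 2) * t N.
  rewrite sE (le_trans (qsum _ _ _))//.
  by rewrite /t -(big_mkord xpredT (fun k => q (f k) (f k))).
have qQ : q (u - s N) (u - s N) <= nsq u * (eps / 2).
  have cv : q (s n - s N) (s n - s N) @[n --> \oo] --> q (u - s N) (u - s N).
    apply: (bounded_form_cvg (u := fun n => s n - s N) qP qb).
    have -> : (fun n => nsq (s n - s N - (u - s N))) = (fun n => nsq (s n - u)).
      by apply/funext => n; rewrite opprB addrA subrK.
    exact: (parseval_cvg dotP u fB).
  apply: (ler_cvg_to cv (cvg_cst _)).
  exists N => // n /= Nn.
  have -> : s n - s N = \sum_(N <= k < n) c k *: f k.
    by rewrite !sE (big_cat_nat (leq0n N) Nn)/= [X in X - _]addrC addrK.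
  rewrite (le_trans (qsum _ _ _))//.
  apply: ler_pM.
  - by apply: sumr_ge0 => i _; exact: sqr_ge0.
  - by apply: sumr_ge0 => i _; exact: (dot_ge0 qP).
  - apply: (bessel dotP); first exact: iota_uniq.
    by move=> i j _ _; exact: fB.1.
  - rewrite (le_trans _ (HN n Nn))// /t.
    rewrite -!(big_mkord xpredT (fun k => q (f k) (f k))).
    by rewrite (big_cat_nat (leq0n N) Nn)/= [X in X - _]addrC addrK.
have qu : q u u <= 2 * q (s N) (s N) + 2 * q (u - s N) (u - s N).
  by rewrite -{1 2}(subrK (s N) u) addrC (nsqD_le qP).
rewrite (le_trans qu)// big_map.
have -> : \sum_(j <- index_iota 0 N) dot u (Num.sqrt (2 * t N) *: f j) ^+ 2 =
    2 * ((\sum_(0 <= k < N) c k ^+ 2) * t N).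
  rewrite mulrCA mulr_suml; apply: eq_bigr => k _.
  by rewrite (dotZr dotP) exprMn sqr_sqrtr ?mulr_ge0// mulrC.
have : eps * nsq u = 2 * (nsq u * (eps / 2)) by field.
by move: qP1 qQ; lra.
Qed.

End trace_class.
(** * The space L^2 *)

Section L2_space.
Context (d : measure_display) (T : measurableType d) (R : realType).
Variables (mu : {measure set T -> \bar R}) (A : set T).
Hypothesis mA : measurable A.

Lemma L2_LnormE (f : T -> R) :
  'N[mu]_2%:E[EFin \o (f \_ A)]%E =
  ((\int[mu]_(x in A) (f x ^+ 2)%:E) `^ 2^-1)%E.
Proof.
rewrite unlock; congr (_ `^ _)%E; rewrite [RHS]integral_mkcond.
apply: eq_integral => x _ /=; rewrite !patchE.
case: ifPn => _; last by rewrite normr0 powR0.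
by rewrite powR_mulrn// real_normK ?num_real.
Qed.

Lemma L2P (f : T -> R) : L2 mu A f <->
  measurable_fun A f /\ mu.-integrable A (EFin \o (fun x => f x ^+ 2)).
Proof.
split=> [Lf|[mf sf]].
- split.
    move: Lf; rewrite /L2 inE => /andP[/[!inE]/= + _].
    by move=> /(measurable_restrictT _ mA).2.
  apply/(integrable_mkcond _ mA); have := Lfun2_integrable_sqr Lf.
  congr (_.-integrable _ _); apply/funext => x /=.
  by rewrite !patchE; case: ifPn => // _; rewrite expr0n.
- rewrite /L2 inE; apply/andP; split; rewrite inE/=.
    exact/(measurable_restrictT _ mA).1.
  rewrite /finite_norm L2_LnormE poweR_lty//.
  move/integrableP : sf => [_]; apply: le_lt_trans.
  rewrite le_eqVlt; apply/orP; left; apply/eqP/eq_integral => x _ /=.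
  by rewrite ger0_norm// sqr_ge0.
Qed.

Lemma L2_mul_integrable (f g : T -> R) : L2 mu A f -> L2 mu A g ->
  mu.-integrable A (EFin \o (fun x => f x * g x)).
Proof.
move=> Lf Lg; apply/(integrable_mkcond _ mA).
have /Lfun1_integrable := Lfun2_mul_Lfun1 Lf Lg.
congr (_.-integrable _ _); apply/funext => x /=.
by rewrite !patchE; case: ifPn => // _; rewrite mulr0.
Qed.

Lemma L2_submod_closed : submod_closed (fun f : T -> R => f \_ A \in Lfun mu 2%:E).
Proof.
have two1 : (1 <= 2%:E :> \bar R)%E by rewrite lee_fin ler1n.
have [L0 LD] := Lfun_submod_closed mu two1; split.
  rewrite unfold_in (_ : _ \_ _ = 0)//; apply/funext => x.
  by rewrite patchE; case: ifPn.
move=> a f g Lf Lg; rewrite unfold_in.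
rewrite (_ : _ \_ _ = a *: (f \_ A) + g \_ A); first exact: LD.
apply/funext => x; rewrite patchE /= !fctE !patchE.
by case: ifPn => // _; rewrite scaler0 addr0.
Qed.

End L2_space.

Definition L2pred (d : measure_display) (T : measurableType d) (R : realType)
  (mu : {measure set T -> \bar R}) (A : set T) : {pred T -> R} :=
  fun f => f \_ A \in Lfun mu 2%:E.

HB.instance Definition _ (d : measure_display) (T : measurableType d)
  (R : realType) (mu : {measure set T -> \bar R}) (A : set T) :=
  GRing.isSubmodClosed.Build R (T -> R) (L2pred mu A) (L2_submod_closed mu A).

Record L2vec (d : measure_display) (T : measurableType d) (R : realType)
  (mu : {measure set T -> \bar R}) (A : set T) :=
  L2Vec { L2val :> T -> R ; L2valP : L2val \in L2pred mu A }.

HB.instance Definition _ (d : measure_display) (T : measurableType d)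
  (R : realType) (mu : {measure set T -> \bar R}) (A : set T) :=
  [isSub for @L2val d T R mu A].
HB.instance Definition _ (d : measure_display) (T : measurableType d)
  (R : realType) (mu : {measure set T -> \bar R}) (A : set T) :=
  [Choice of L2vec mu A by <:].
HB.instance Definition _ (d : measure_display) (T : measurableType d)
  (R : realType) (mu : {measure set T -> \bar R}) (A : set T) :=
  [SubChoice_isSubLmodule of L2vec mu A by <:].

Section L2vec_theory.
Context (d : measure_display) (T : measurableType d) (R : realType).
Variables (mu : {measure set T -> \bar R}) (A : set T).
Hypothesis mA : measurable A.
Local Notation V := (L2vec mu A).
Local Notation dot := (fun f g : V => L2_dot mu A f g).

Lemma L2vecP (f : V) : L2 mu A f.
Proof. exact: L2valP. Qed.

Lemma L2valZ a (f : V) x : (a *: f) x = a * f x.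
Proof. by []. Qed.

Lemma L2val_sum (I : Type) (r : seq I) (F : I -> V) x :
  (\sum_(i <- r) F i) x = \sum_(i <- r) F i x.
Proof. by elim/big_rec2: _ => // i y z _ <-. Qed.

Lemma L2_dotP : semi_inner dot.
Proof.
split=> [u v|u v w|a u v|u] /=.
- by apply: eq_Rintegral => x _; rewrite mulrC.
- rewrite /L2_dot -RintegralD//; try exact: L2_mul_integrable (L2vecP _) (L2vecP _).
  by apply: eq_Rintegral => x _; exact: mulrDl.
- rewrite /L2_dot -RintegralZl//; last exact: L2_mul_integrable (L2vecP _) (L2vecP _).
  by apply: eq_Rintegral => x _; rewrite mulrA.
- by apply: Rintegral_ge0 => x _; rewrite -expr2 sqr_ge0.
Qed.

Lemma L2_nsqE (f : T -> R) : L2 mu A f ->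
  (\int[mu]_(x in A) (f x ^+ 2)%:E)%E = (L2_dot mu A f f)%:E.
Proof.
move=> Lf; rewrite /L2_dot /Rintegral fineK.
  by apply: eq_integral => x _; rewrite expr2.
exact: (integrable_fin_num mA (L2_mul_integrable mA Lf Lf)).
Qed.

Lemma L2_dot_ae0 (u : T -> R) : L2 mu A u ->
  {ae mu, forall x, A x -> u x = 0} -> L2_dot mu A u u = 0.
Proof.
move=> Lu u0; have [mu_ _] := (L2P mu mA u).1 Lu.
apply/EFin_inj; rewrite -L2_nsqE//.
rewrite (ae_eq_integral (cst 0%E)) ?integral0//.
- by apply/measurable_EFinP/measurable_funX.
- by apply: filterS u0 => x ux Ax; rewrite ux// expr0n.
Qed.

End L2vec_theory.

(** * Completeness of L^2 *)

Lemma geometric_half_cvg0 (R : realType) (c : R) : c / 2 ^+ k @[k --> \oo] --> 0.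
Proof.
have -> : (fun k => c / 2 ^+ k) = geometric c 2^-1.
  by apply/funext => k; rewrite /geometric/= exprVn.
by apply: cvg_geometric; rewrite ger0_norm ?invr_ge0// invf_lt1// ltr1n.
Qed.

Lemma sum_half_le2 (R : realType) n : \sum_(k < n) (2 ^- k : R) <= 2.
Proof.
suff -> : \sum_(k < n) (2 ^- k : R) = 2 - 2 / 2 ^+ n.
  by rewrite gerBl divr_ge0// exprn_ge0.
elim: n => [|n IH]; first by rewrite big_ord0 expr0 divr1 subrr.
rewrite big_ord_recr/= IH exprS; field.
by rewrite expf_neq0// pnatr_eq0.
Qed.

(** The intervals of radius 2 * c / 2 ^ k around a k are nested, the radius being the sum of all
    later increment bounds; the supremum of their left ends lies in each of them. *)
Lemma geometric_increments_cvg (R : realType) (a : nat -> R) (c : R) : 0 <= c ->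
  (forall k, `|a k.+1 - a k| <= c / 2 ^+ k) ->
  exists l, forall k, `|l - a k| <= 2 * c / 2 ^+ k.
Proof.
move=> c0 Ha.
have half k : 2 * c / 2 ^+ k.+1 = c / 2 ^+ k.
  by rewrite exprS; field; rewrite expf_neq0// pnatr_eq0.
have dbl k : 2 * c / 2 ^+ k = 2 * (c / 2 ^+ k) by rewrite mulrA.
pose lo k := a k - 2 * c / 2 ^+ k; pose hi k := a k + 2 * c / 2 ^+ k.
have ndlo : {homo lo : n m / (n <= m)%N >-> n <= m}.
  apply/nondecreasing_seqP => k; have := Ha k.
  rewrite /lo half dbl ler_norml => /andP[]; move: (c / 2 ^+ k) => x.
  by lra.
have nihi : {homo hi : n m / (n <= m)%N >-> m <= n}.
  apply/nonincreasing_seqP => k; have := Ha k.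
  rewrite /hi half dbl ler_norml => /andP[]; move: (c / 2 ^+ k) => x.
  by lra.
have lohi n m : lo n <= hi m.
  rewrite (le_trans (ndlo _ _ (leq_maxl n m)))//.
  rewrite (le_trans _ (nihi _ _ (leq_maxr n m)))//.
  have : 0 <= c / 2 ^+ maxn n m by rewrite divr_ge0// exprn_ge0.
  by rewrite /lo /hi dbl; lra.
exists (sup (range lo)) => k; rewrite ler_distl; apply/andP; split.
  by apply: ub_le_sup; [exists (hi 0%N) => _ [n _ <-]|exists k].
by apply: ge_sup; [exists (lo 0%N), 0%N|move=> _ [n _ <-]; exact: lohi].
Qed.

Section riesz_fischer.
Context (d : measure_display) (T : measurableType d) (R : realType).
Variables (mu : {measure set T -> \bar R}) (A : set T).
Hypothesis mA : measurable A.
Local Notation V := (L2vec mu A).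

Let L2vec_measurable (f : V) : measurable_fun A f.
Proof. by have [] := (L2P mu mA f).1 (L2vecP f). Qed.

(** The weights 4 ^ k lie between two needs: against 8 ^- k they leave the summable 2 ^- k, so H has
    integral at most 2 and is finite almost everywhere; and where H is finite they force increments
    of size sqrt H / 2 ^ k. Hence |f - v k| <= 2 sqrt H / 2 ^ k, whose square integrates to at most
    8 / 4 ^ k. *)
Let fast_cauchy_cvg (v : nat -> V) :
  (forall k, L2_dot mu A (v k.+1 - v k) (v k.+1 - v k) <= 8 ^- k) ->
  exists f : V, forall k, L2_dot mu A (v k - f) (v k - f) <= 8 / 4 ^+ k.
Proof.
move=> Hv.
pose g k x := v k.+1 x - v k x.
pose h k x := (4 ^+ k * g k x ^+ 2)%:E.
pose H x := (\sum_(0 <= k <oo) h k x)%E.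
have mg k : measurable_fun A (g k) by exact: measurable_funB.
have mh k : measurable_fun A (h k).
  apply/measurable_EFinP; apply: measurable_funM => //.
  exact: measurable_funX.
have h0 k x : (0 <= h k x)%E.
  by rewrite lee_fin mulr_ge0 ?sqr_ge0// exprn_ge0.
have mH : measurable_fun A H by exact: ge0_emeasurable_sum.
have H0 x : (0 <= H x)%E by exact: nneseries_ge0.
have intH : (\int[mu]_(x in A) H x <= 2%:E)%E.
  rewrite integral_nneseries//.
  apply: lime_le; first by apply: is_cvg_nneseries => n _ _; exact: integral_ge0.
  apply: nearW => n; rewrite big_mkord.
  apply: (@le_trans _ _ (\sum_(k < n) (2 ^- k : R))%:E); last first.
    by rewrite lee_fin sum_half_le2.
  rewrite -sumEFin; apply: lee_sum => k _.
  have -> : (\int[mu]_(x in A) h k x =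
      (4 ^+ k)%:E * \int[mu]_(x in A) (g k x ^+ 2)%:E)%E.
    rewrite -ge0_integralZl//.
    - by apply/measurable_EFinP; exact: measurable_funX.
    - by move=> x _; rewrite lee_fin sqr_ge0.
  rewrite (L2_nsqE mA (L2vecP (v k.+1 - v k))) -EFinM lee_fin.
  rewrite (le_trans (ler_wpM2l _ (Hv k))) ?exprn_ge0//.
  rewrite (_ : 8 = 4 * 2); last by ring.
  by rewrite exprMn invfM mulrA divff ?mul1r// expf_neq0// pnatr_eq0.
have iH : mu.-integrable A H.
  apply/integrableP; split => //.
  rewrite (eq_integral H) => [|x _]; last by rewrite gee0_abs.
  by rewrite (le_lt_trans intH)// ltry.
pose E := A `&` [set x | (H x < +oo)%E].
have mE : measurable E by exact: emeasurable_fun_infty_o.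
have aeE : {ae mu, forall x, A x -> E x}.
  have := integrable_ae mA iH; apply: filterS => x Hx Ax; split => //=.
  by rewrite ltey_eq Hx.
have Hg x k : E x -> `|v k.+1 x - v k x| <= Num.sqrt (fine (H x)) / 2 ^+ k.
  move=> [_ /= Hoo].
  have Hfin : H x \is a fin_num by rewrite ge0_fin_numE.
  have hH : (h k x <= H x)%E.
    apply: (@le_trans _ _ (\sum_(0 <= i < k.+1) h i x)%E).
      by rewrite big_nat_recr//= leeDr// sume_ge0.
    by apply: nneseries_lim_ge => n _ _; exact: h0.
  have hk : 4 ^+ k * g k x ^+ 2 <= fine (H x) by rewrite -lee_fin fineK.
  rewrite -(@ler_pXn2r _ 2)// ?nnegrE ?divr_ge0 ?sqrtr_ge0 ?exprn_ge0//.
  rewrite real_normK ?num_real// expr_div_n sqr_sqrtr ?fine_ge0//.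
  rewrite -exprM mulnC exprM -natrX ler_pdivlMr ?exprn_gt0//.
  by rewrite mulrC.
(* The value 0 outside E makes f the limit on all of A of the restrictions of v k to E, hence
   measurable. *)
have /choice[f Hf] : forall x, exists l : R,
    (E x -> forall k, `|l - v k x| <= 2 * Num.sqrt (fine (H x)) / 2 ^+ k) /\
    (~ E x -> l = 0).
  move=> x; have [Ex|nEx] := pselect (E x); last by exists 0.
  have [l Hl] := geometric_increments_cvg (sqrtr_ge0 _) (fun k => Hg x k Ex).
  by exists l.
have mf : measurable_fun A f.
  apply: (@measurable_fun_cvg _ _ _ _ (fun k => v k \_ E)).
    move=> k; apply/(measurable_restrict _ mE mA).
    exact: measurable_funS (L2vec_measurable (v k)).
  move=> x Ax; have [HE HN] := Hf x.
  have [Ex|nEx] := pselect (E x); last first.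
    by rewrite HN//; apply: cvg_near_cst; apply: nearW => k; rewrite patchE memNset.
  have -> : (fun k => (v k \_ E) x) = (fun k => v k x).
    by apply/funext => k; rewrite patchE mem_set.
  apply/subr_cvg0; apply: norm_cvg0.
  apply: (@squeeze_cvgr _ _ _ _ (cst 0)
    (fun k => 2 * Num.sqrt (fine (H x)) / 2 ^+ k)).
  - by apply: nearW => k; rewrite normr_ge0/= distrC HE.
  - exact: cvg_cst.
  - exact: geometric_half_cvg0.
have key k : (\int[mu]_(x in A) ((v k x - f x) ^+ 2)%:E <= (8 / 4 ^+ k)%:E)%E.
  apply: (@le_trans _ _ (\int[mu]_(x in A) ((4 / 4 ^+ k)%:E * H x))%E).
    apply: ae_ge0_le_integral => //.
    - by move=> x _; rewrite lee_fin sqr_ge0.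
    - by apply/measurable_EFinP/measurable_funX/measurable_funB.
    - by move=> x _; rewrite mule_ge0// lee_fin divr_ge0// exprn_ge0.
    - exact: measurable_funeM.
    - apply: filterS aeE => x AE Ax; have Ex := AE Ax.
      have [/(_ Ex k) Hk _] := Hf x.
      have Hfin : H x \is a fin_num by rewrite ge0_fin_numE//; exact: Ex.2.
      rewrite -(fineK Hfin) -EFinM lee_fin.
      rewrite -real_normK ?num_real// distrC.
      have Hk2 : `|f x - v k x| ^+ 2 <= (2 * Num.sqrt (fine (H x)) / 2 ^+ k) ^+ 2.
        by rewrite ler_pXn2r ?nnegrE// ?divr_ge0 ?mulr_ge0 ?sqrtr_ge0 ?exprn_ge0.
      rewrite (le_trans Hk2)//.
      rewrite expr_div_n exprMn sqr_sqrtr ?fine_ge0//.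
      rewrite -exprM mulnC exprM -!natrX.
      by rewrite mulrAC.
  rewrite ge0_integralZl//.
  apply: (@le_trans _ _ ((4 / 4 ^+ k)%:E * 2%:E)%E).
    by rewrite lee_wpmul2l// lee_fin divr_ge0// exprn_ge0.
  by rewrite -EFinM lee_fin mulrAC -natrM.
have Lvf k : L2 mu A (v k \- f).
  apply/(L2P mu mA); split; first exact: measurable_funB.
  apply/integrableP; split.
    by apply/measurable_EFinP/measurable_funX/measurable_funB.
  rewrite (eq_integral (fun x => ((v k x - f x) ^+ 2)%:E)); last first.
    by move=> x _; rewrite gee0_abs// lee_fin sqr_ge0.
  by rewrite (le_lt_trans (key k))// ltry.
have Lf : f \in L2pred mu A.
  have := L2valP (v 0%N - L2Vec (Lvf 0%N)).
  rewrite (_ : L2val _ = f)//; apply/funext => x.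
  exact: subKr.
exists (L2Vec Lf) => k; rewrite -lee_fin -L2_nsqE//; last exact: L2vecP.
exact: key.
Qed.

Theorem riesz_fischer : dot_complete (fun f g : V => L2_dot mu A f g).
Proof.
move=> u uC.
have dP := L2_dotP mu mA.
have /choice[N HN] : forall k : nat, exists N, forall i j, (N <= i)%N -> (N <= j)%N ->
    L2_dot mu A (u i - u j) (u i - u j) <= 8 ^- k.
  by move=> k; apply: uC; rewrite invr_gt0 exprn_gt0.
(* The sum dominates N j for every j <= k, so n k and n k.+1 are both at least N k. *)
pose n k := (\sum_(j < k.+1) N j)%N.
have nN k j : (j <= k)%N -> (N j <= n k)%N.
  by rewrite -ltnS => jk; rewrite /n (bigD1 (Ordinal jk))//= leq_addr.
have [k|f Hf] := @fast_cauchy_cvg (fun k => u (n k)).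
  by apply: HN; apply: nN.
exists f.
apply/cvgrPdist_le => e e0.
(* 18 = 2 * 1 + 2 * 8: the factors of [nsqD_le] times the bounds [h1] and [h2] below. *)
have /cvgrPdist_le/(_ _ e0)[k _ Hk] := geometric_half_cvg0 (18 : R).
exists (n k) => // i /= ni.
rewrite sub0r normrN ger0_norm; last exact: (dot_ge0 dP (u i - f)).
have := Hk k (leqnn k) => /=; rewrite sub0r normrN ger0_norm ?divr_ge0 ?exprn_ge0//.
apply: le_trans.
have := nsqD_le dP (u i - u (n k)) (u (n k) - f); rewrite /= addrA subrK.
have h1 : L2_dot mu A (u i - u (n k)) (u i - u (n k)) <= 2 ^- k.
  rewrite (le_trans (HN k _ _ _ _)) ?(leq_trans _ ni) ?nN//.
  by rewrite lef_pV2 ?posrE ?exprn_gt0// lerXn2r ?nnegrE// ler_nat.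
have h2 : L2_dot mu A (u (n k) - f) (u (n k) - f) <= 8 / 2 ^+ k.
  rewrite (le_trans (Hf k))// ler_pM2l// lef_pV2 ?posrE ?exprn_gt0//.
  by rewrite lerXn2r ?nnegrE// ler_nat.
by move: h1 h2 => /=; move: (2 ^- k) => x; lra.
Qed.

End riesz_fischer.

(** * Indicator functions; separability and infinite dimension of L^2(D) *)

Section L2_indic.
Context (d : measure_display) (T : measurableType d) (R : realType).
Variables (mu : {measure set T -> \bar R}) (A : set T).
Hypothesis mA : measurable A.

Lemma indic_sqr (B : set T) x : (\1_B x ^+ 2 : R) = \1_B x.
Proof. by rewrite indicE; case: (x \in B); rewrite ?expr1n ?expr0n. Qed.

Lemma L2_indic (B : set T) : measurable B -> (mu B < +oo)%E ->
  L2 mu A (\1_B : T -> R).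
Proof.
move=> mB Boo; apply/(L2P mu mA); split; first exact: measurable_indic.
rewrite (_ : EFin \o _ = EFin \o \1_B); last first.
  by apply/funext => x /=; rewrite indic_sqr.
apply/integrableP; split; first exact/measurable_EFinP/measurable_indic.
rewrite (eq_integral (fun x => (\1_B x)%:E)) => [|x _]; last first.
  by rewrite gee0_abs// lee_fin.
rewrite integral_indic//; apply: le_lt_trans Boo; apply: le_measure; rewrite ?inE//.
exact: measurableI.
Qed.

Lemma L2_dot_indic (B : set T) : measurable B ->
  L2_dot mu A \1_B \1_B = fine (mu (B `&` A)).
Proof.
move=> mB; rewrite -integral_indic//; congr fine.
by apply: eq_integral => x _; rewrite -expr2 indic_sqr.
Qed.

End L2_indic.

Section lebesgue_L2.
Context (R : realType).
Local Notation mu := (@lebesgue_measure R).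

(* The primitive of f on [a, b] is continuous and vanishes at the rationals,
   hence everywhere, and its derivative is almost everywhere f. *)
Lemma ae_eq0_of_rat_integrals (f : R -> R) (a b : R) : a < b ->
  mu.-integrable `[a, b] (EFin \o f) ->
  (forall q : rat, \int[mu]_(t in `[a, ratr q]) (f \_ `[a, b]) t = 0) ->
  {ae mu, forall x, a < x < b -> f x = 0}.
Proof.
move=> ab intf Hq.
pose g := f \_ `[a, b].
have intg : mu.-integrable setT (EFin \o g).
  by rewrite /g -restrict_EFin; apply/integrable_restrict => //=; rewrite setTI.
have locg : locally_integrable setT g by exact: integrable_locally_restrict.
pose F x := \int[mu]_(t in `[a, x]) g t.
have F0 x : a < x < b -> F x = 0.
  move=> /andP[ax xb].
  have contF : {within `[a, b], continuous F}.
    apply: parameterized_integral_continuous; first exact: ltW.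
    exact: (integrableS measurableT).
  have [cF _ _] := (continuous_within_itvP F ab).1 contF.
  have {}cF : {for x, continuous F} by apply: cF; rewrite in_itv/= ax xb.
  apply: contrapT => /eqP Fx.
  have Fe : 0 < `|F x| by rewrite normr_gt0.
  have /cvgrPdist_lt/(_ _ Fe)/nbhs_ballP[e /= e0 He] := cF.
  have [y [xq [q _ qE]]] := @dense_rat R (ball x e) (ex_intro _ x (ballxx x e0))
    (ball_open x e).
  rewrite -qE in xq; have := He _ xq; rewrite /= {2}/F Hq subr0.
  by rewrite ltxx.
have intgy y : mu.-integrable `[a, y] (EFin \o g).
  exact: (integrableS measurableT).
have := @FTC1 R g (BLeft a) intgy locg.
apply: filterS; first exact: (ae_filter_ringOfSetsType mu).
move=> x /= Hx /andP[ax xb].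
have [|_] := Hx; first by rewrite lte_fin.
have -> : g x = f x by rewrite /g patchE mem_set//= in_itv/= !ltW.
move=> <-.
suff : derive1 F x = 0 by [].
rewrite derive1E (@near_eq_derive _ _ _ F (cst 0)) ?derive_cst//.
near=> y; apply: F0; apply/andP; split; near: y.
- exact: lt_nbhsr.
- exact: lt_nbhsl.
Unshelve. all: by end_near. Qed.

Variable D : set R.
Hypothesis mD : measurable D.
Local Notation V := (L2vec mu D).
Local Notation dot := (fun f g : V => L2_dot mu D f g).

(** Orthogonality to the indicators of [-(N+1), q] cut to [-(N+1), N+1] says that the primitive of u
    on the latter interval vanishes at the rationals, so u is null there for every N. *)
Lemma lebesgue_L2_countably_total : countably_total dot.
Proof.
pose I (N : nat) (q : rat) : set R := `[- N.+1%:R, ratr q] `&` `[- N.+1%:R, N.+1%:R].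
have mI N q : measurable (I N q) by exact: measurableI.
have Joo N : (mu `[(- N.+1%:R : R)%R, (N.+1%:R : R)%R] < +oo)%E.
  by rewrite lebesgue_measure_itv/=; case: ifPn => // _; rewrite -EFinD ltry.
have LI N q : (\1_(I N q) : R -> R) \in L2pred mu D.
  apply: (@L2_indic _ _ _ mu D mD); first exact: mI.
  apply: (@le_lt_trans _ _ (mu `[(- N.+1%:R : R)%R, (N.+1%:R : R)%R])).
    by apply: le_measure; rewrite ?inE//; [exact: mI|exact: subIsetr].
  exact: Joo.
pose g k : V := if unpickle k is Some (N, q) then L2Vec (LI N q) else 0.
exists g => u Hu.
have HI N q : L2_dot mu D u \1_(I N q) = 0.
  by have := Hu (pickle (N, q)); rewrite /g pickleK.
have [mu_ _] := (L2P mu mD u).1 (L2vecP u).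
have aeN N : {ae mu, forall x, - N.+1%:R < x < N.+1%:R -> (u \_ D) x = 0}.
  apply: ae_eq0_of_rat_integrals; first by rewrite gtrN.
    have LN : L2 mu D (\1_(`[- N.+1%:R, N.+1%:R] : set R) : R -> R).
      apply: (@L2_indic _ _ _ mu D mD); first exact: measurable_itv.
      exact: Joo.
    have /(@integrable_mkcond _ _ _ mu D _ mD).1 :=
      @L2_mul_integrable _ _ _ mu D mD _ _ (L2vecP u) LN.
    move=> h; apply/(@integrable_mkcond _ _ _ mu _ _ (measurable_itv _)).
    move: h; congr (_.-integrable _ _); apply/funext => x /=.
    rewrite !patchE /= !patchE indicE.
    case: (x \in D) => /=; case: (x \in `[_, _]%classic) => //=.
    + by rewrite mulr1.
    + by rewrite mulr0.
  move=> q; rewrite -(HI N q) /L2_dot Rintegral_mkcond [RHS]Rintegral_mkcond.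
  apply: eq_Rintegral => x _.
  rewrite !patchE indicE in_setI; case: (x \in D) => /=.
    by case: (x \in `[_, ratr q]%classic); case: (x \in `[_, N.+1%:R]%classic);
      rewrite ?mulr1 ?mulr0.
  by case: (x \in `[_, ratr q]%classic); case: (x \in `[_, N.+1%:R]%classic).
have aeu : {ae mu, forall x, D x -> u x = 0}.
  have := ae_foralln aeN; apply: filterS => x Hx Dx.
  have := Hx (Num.truncn `|x|); rewrite patchE mem_set//; apply.
  by rewrite -ltr_norml truncnS_gt.
exact: (@L2_dot_ae0 _ _ _ mu D mD _ (L2vecP u)).
Qed.

(** D is infinite, since a countable set is Lebesgue-null. Around n distinct points of D take
    disjoint balls; each meets D in positive measure, so their indicators can be normalised. *)
Lemma lebesgue_L2_infinite_dim : D !=set0 -> locally_nonnull D ->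
  infinite_dim dot.
Proof.
move=> [t0 Dt0] nnD n.
have infD : infinite_set D.
  move=> /finite_set_countable cD; have := nnD _ Dt0 1 ltr01.
  rewrite (_ : mu _ = 0%E) ?ltxx//; apply: countable_lebesgue_measure0.
  by apply: sub_countable cD; apply: subset_card_le; exact: subIsetl.
have [X XD Xn] := infinite_set_fset n infD.
pose t (i : nat) := nth 0 (finmap.enum_fset X) i.
have tD i : (i < n)%N -> D (t i).
  by move=> iN; apply: XD; apply: mem_nth; exact: leq_trans Xn.
have tinj i j : (i < n)%N -> (j < n)%N -> i != j -> t i != t j.
  move=> iN jN; rewrite nth_uniq ?(leq_trans _ Xn)//; exact: finmap.fset_uniq.
(* At most half the least distance between two of the points; the default 1 keeps r positive when
   there is no pair. *)
pose r : R := \big[Order.min/1]_(p : 'I_n * 'I_n | p.1 != p.2)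
  (`|t p.1 - t p.2| / 2).
have r0 : 0 < r.
  apply/bigmin_gtP; split => // -[i j] /= ij.
  by rewrite divr_gt0// normr_gt0 subr_eq0 tinj.
have rt i j : (i < n)%N -> (j < n)%N -> i != j -> 2 * r <= `|t i - t j|.
  move=> iN jN ij; rewrite mulrC -ler_pdivlMr//.
  exact: (bigmin_le_cond 1 (fun p : 'I_n * 'I_n => `|t p.1 - t p.2| / 2)
    (j := (Ordinal iN, Ordinal jN))).
pose B i : set R := ball (t i) r.
have mB i : measurable (B i) by exact: measurable_ball.
have Boo i : (mu (B i) < +oo)%E.
  by rewrite lebesgue_measure_ball ?ltry// ltW.
have LB i : (\1_(B i) : R -> R) \in L2pred mu D.
  by apply: (@L2_indic _ _ _ mu D mD); [exact: mB|exact: Boo].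
pose m i := fine (mu (B i `&` D)).
have m0 i : (i < n)%N -> 0 < m i.
  move=> iN; apply: fine_gt0; apply/andP; split.
    by rewrite setIC; apply: nnD => //; exact: tD.
  apply: le_lt_trans (Boo i); apply: le_measure; rewrite ?inE//.
    exact: (measurableI _ _ (mB i) mD).
  exact: mB.
have dP := L2_dotP mu mD.
exists (fun i => (Num.sqrt (m i))^-1 *: L2Vec (LB i)) => i j iN jN.
rewrite (dotZl dP) (dotZr dP) /=.
have [<-|ij] := eqVneq i j.
  rewrite (@L2_dot_indic _ _ _ mu D mD _ (mB i)) -/(m i) mulrA -expr2 exprVn.
  by rewrite sqr_sqrtr ?ltW ?m0// mulVf// gt_eqF ?m0.
rewrite (_ : L2_dot _ _ _ _ = 0) ?mulr0//.
rewrite /L2_dot (eq_Rintegral mu (g := fun=> 0)) => [|x _].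
  by rewrite /Rintegral integral0.
rewrite !indicE /=; case: (boolP (x \in B i)) => xi; last by rewrite mul0r.
case: (boolP (x \in B j)) => xj; last by rewrite mulr0.
move: xi xj; rewrite !inE /B /ball/= => xi xj.
have := rt _ _ iN jN ij.
have := ler_normB (t i - x) (t j - x); rewrite opprB addrA subrK.
by move: xi xj; lra.
Qed.

End lebesgue_L2.
Section L2_convergence.
Context (d : measure_display) (T : measurableType d) (R : realType).
Variables (mu : {measure set T -> \bar R}) (A : set T).
Hypothesis mA : measurable A.

Lemma L2_cvg_nsq (u : nat -> L2vec mu A) (f : L2vec mu A) :
  L2_dot mu A (u n - f) (u n - f) @[n --> \oo] --> 0 ->
  L2_cvg mu A (fun n => u n) f.
Proof.
move=> uf; split=> [n||]; [exact: L2vecP|exact: L2vecP|].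
have -> : (fun n => 'N[mu]_2%:E[EFin \o ((u n \- f)%R \_ A)]%E) =
    (fun n => (Num.sqrt (L2_dot mu A (u n - f) (u n - f)))%:E).
  apply/funext => n; rewrite L2_LnormE.
  rewrite (@L2_nsqE _ _ _ mu A mA _ (L2vecP (u n - f))).
  by rewrite poweR_EFin powR12_sqrt// (dot_ge0 (L2_dotP mu mA) (u n - f)).
apply: cvg_EFin; first exact: nearW.
suff : Num.sqrt (L2_dot mu A (u n - f) (u n - f)) @[n --> \oo] --> Num.sqrt (0 : R).
  by rewrite sqrtr0.
by apply: continuous_cvg => //; exact: sqrt_continuous.
Qed.

Lemma parseval_orthonormal_basis (e : nat -> L2vec mu A) :
  parseval_basis (fun f g : L2vec mu A => L2_dot mu A f g) e ->
  orthonormal_basis mu A (fun i => e i).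
Proof.
move=> eB; split=> [i|i j|u Lu]; [exact: L2vecP|exact: eB.1|].
have := parseval_cvg (L2_dotP mu mA) (L2Vec Lu) eB.
move=> /L2_cvg_nsq; congr (L2_cvg _ _ _ _).
apply/funext => n; apply/funext => x.
by rewrite L2val_sum; apply: eq_bigr.
Qed.

(** The bound g is extended-valued because it will be an integral over sections, which may be
    infinite on a null set. *)
Lemma L2_bound (f : T -> R) (g : T -> \bar R) : measurable_fun A f ->
  measurable_fun A g -> {ae mu, forall x, A x -> ((f x ^+ 2)%:E <= g x)%E} ->
  (forall x, A x -> (0 <= g x)%E) ->
  (\int[mu]_(x in A) g x < +oo)%E -> L2 mu A f.
Proof.
move=> mf mg fg g0 gy; apply/(L2P mu mA); split => //; apply/integrableP; split.
  by apply/measurable_EFinP/measurable_funX.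
apply: le_lt_trans gy; apply: ae_ge0_le_integral => //.
- by apply/measurableT_comp => //; apply/measurable_EFinP/measurable_funX.
- apply: filterS fg => x fgx Ax.
  by rewrite gee0_abs ?fgx// lee_fin sqr_ge0.
Qed.

End L2_convergence.
(** * Integral operators with square integrable kernels *)

Section measurable_partial_integrals.
Context (d1 d2 : measure_display) (T1 : measurableType d1)
  (T2 : measurableType d2) (R : realType).
Variables (m1 : {sigma_finite_measure set T1 -> \bar R})
  (m2 : {sigma_finite_measure set T2 -> \bar R}) (f : T1 * T2 -> \bar R).
Hypothesis mf : measurable_fun [set: T1 * T2] f.

(** No integrability is assumed: Tonelli applies to the positive and negative parts, which are then
    subtracted in the extended reals. *)
Lemma measurable_partial_integral1 :
  measurable_fun [set: T1] (fun x => \int[m2]_y f (x, y))%E.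
Proof.
rewrite (_ : (fun x => _) = (fubini_F m2 f^\+ \- fubini_F m2 f^\-)%E); last first.
  by apply/funext => x; rewrite integralE /fubini_F; congr (_ - _)%E;
    apply: eq_integral => y _; rewrite ?funeposE ?funenegE.
apply: emeasurable_funB.
- apply: (measurable_fun_fubini_tonelli_F (m2 := m2) (f^\+)%E) => //.
  exact: measurable_funepos.
- apply: (measurable_fun_fubini_tonelli_F (m2 := m2) (f^\-)%E) => //.
  exact: measurable_funeneg.
Qed.

Lemma measurable_partial_integral2 :
  measurable_fun [set: T2] (fun y => \int[m1]_x f (x, y))%E.
Proof.
rewrite (_ : (fun y => _) = (fubini_G m1 f^\+ \- fubini_G m1 f^\-)%E); last first.
  by apply/funext => y; rewrite integralE /fubini_G; congr (_ - _)%E;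
    apply: eq_integral => x _; rewrite ?funeposE ?funenegE.
apply: emeasurable_funB.
- apply: (measurable_fun_fubini_tonelli_G (m1 := m1) (f^\+)%E) => //.
  exact: measurable_funepos.
- apply: (measurable_fun_fubini_tonelli_G (m1 := m1) (f^\-)%E) => //.
  exact: measurable_funeneg.
Qed.

End measurable_partial_integrals.

(* For a process X, [kernel_op u] is the random variable \int_D X_t u(t) dt,
   its adjoint [kernel_adj Y] is t |-> E[Y X_t], and the composite of the two is
   the covariance operator K. *)
Section square_integrable_kernel.
Context (d1 d2 : measure_display) (T1 : measurableType d1)
  (T2 : measurableType d2) (R : realType).
Variables (m1 : {sigma_finite_measure set T1 -> \bar R})
  (m2 : {sigma_finite_measure set T2 -> \bar R}).
Variables (A : set T2) (X : T2 -> T1 -> R).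
Hypothesis mA : measurable A.
Hypothesis L2X : L2 (m1 \x m2)%E ([set: T1] `*` A) (fun z => X z.2 z.1).
Hypothesis XL2 : forall t, A t -> L2 m1 [set: T1] (X t).
Local Notation V1 := (L2vec m1 [set: T1]).
Local Notation V2 := (L2vec m2 A).
Local Notation dot1 := (fun f g : V1 => L2_dot m1 [set: T1] f g).
Local Notation dot2 := (fun f g : V2 => L2_dot m2 A f g).

(** Extension by zero off A gives joint measurability on the whole product, where Tonelli and Fubini
    are applied. *)
Let Z : T1 * T2 -> R := (fun z => X z.2 z.1) \_ ([set: T1] `*` A).

Let ZE w t : Z (w, t) = if t \in A then X t w else 0.
Proof. by rewrite /Z patchE in_setX in_setT. Qed.

Let mZ : measurable_fun [set: T1 * T2] Z.
Proof. by move: L2X; rewrite /L2 inE => /andP[/[!inE]]. Qed.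

Let Zsq_ge0 z : (0 <= (Z z ^+ 2)%:E)%E.
Proof. by rewrite lee_fin sqr_ge0. Qed.

Let mZsq : measurable_fun [set: T1 * T2] (fun z => (Z z ^+ 2)%:E).
Proof. by apply/measurable_EFinP/measurable_funX. Qed.

(** The squared Hilbert-Schmidt norm T of the overview. *)
Definition kernel_nsq : R :=
  fine (\int[(m1 \x m2)%E]_z
    (((fun z => X z.2 z.1) \_ ([set: T1] `*` A)) z ^+ 2)%:E)%E.

Let kernel_nsqE : (\int[(m1 \x m2)%E]_z (Z z ^+ 2)%:E)%E = kernel_nsq%:E.
Proof.
rewrite /kernel_nsq fineK//.
exact: (integrable_fin_num _ (Lfun2_integrable_sqr L2X)).
Qed.

Let sectE1 w (F : R -> \bar R) : F 0 = 0%E ->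
  (\int[m2]_(t in A) F (X t w) = \int[m2]_t F (Z (w, t)))%E.
Proof.
move=> F0; rewrite integral_mkcond; apply: eq_integral => t _.
by rewrite patchE ZE; case: ifPn.
Qed.

Let Nint w := (\int[m2]_(t in A) (X t w ^+ 2)%:E)%E.

Let NintE w : Nint w = (\int[m2]_t (Z (w, t) ^+ 2)%:E)%E.
Proof. by rewrite -(sectE1 _ (F := fun x => (x ^+ 2)%:E)) ?expr0n. Qed.

Let mNint : measurable_fun [set: T1] Nint.
Proof.
rewrite (_ : Nint = fun w => \int[m2]_t (Z (w, t) ^+ 2)%:E)%E; last first.
  by apply/funext => w; exact: NintE.
exact: (measurable_partial_integral1 m2 mZsq).
Qed.

Let Nint_ge0 w : (0 <= Nint w)%E.
Proof. by apply: integral_ge0 => t _; rewrite lee_fin sqr_ge0. Qed.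

Let int_Nint : (\int[m1]_w Nint w = kernel_nsq%:E)%E.
Proof.
rewrite -kernel_nsqE (fubini_tonelli1 _ mZsq)//.
by apply: eq_integral => w _; exact: NintE.
Qed.

Lemma integral_nsq_section : (\int[m2]_(t in A) (L2_dot m1 [set: T1] (X t) (X t))%:E
  = kernel_nsq%:E)%E.
Proof.
rewrite -kernel_nsqE (fubini_tonelli2 _ mZsq)// integral_mkcond.
apply: eq_integral => t _; rewrite patchE /fubini_G; case: ifPn => tA.
  rewrite -L2_nsqE//; last by apply: XL2; rewrite inE in tA.
  by apply: eq_integral => w _; rewrite ZE tA.
rewrite [LHS](_ : _ = 0%E)//; rewrite integral0_eq// => w _.
by rewrite ZE (negPf tA) expr0n.
Qed.

Lemma measurable_nsq_section :
  measurable_fun A (fun t => L2_dot m1 [set: T1] (X t) (X t)).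
Proof.
apply: (@eq_measurable_fun _ _ _ _ _ (fun t => fine (\int[m1]_w (Z (w, t) ^+ 2)%:E)%E)).
  move=> t tA /=; congr fine; apply: eq_integral => w _.
  by rewrite ZE tA expr2.
apply: measurable_funTS; apply: measurableT_comp; first exact: fine_measurable.
exact: (measurable_partial_integral2 m1 mZsq).
Qed.

(** Tonelli makes the integral [Nint] of the squared sections integrable, hence almost everywhere
    finite. The two variables are not on a par: X t is square integrable for every t in A, its
    section at w only for almost every w. *)
Lemma ae_section_L2 : {ae m1, forall w, L2 m2 A (fun t => X t w)}.
Proof.
have iN : m1.-integrable [set: T1] Nint.
  apply/integrableP; split => //.
  rewrite (eq_integral Nint) => [|w _]; last by rewrite gee0_abs.
  by rewrite int_Nint ltry.
have := integrable_ae measurableT iN; apply: filterS => w /(_ I) Nw.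
have mXw : measurable_fun A (fun t => X t w).
  apply: (@eq_measurable_fun _ _ _ _ _ (fun t => Z (w, t))).
    by move=> t tA; rewrite /= ZE tA.
  by apply: measurable_funTS; exact: measurable_fun_pair2.
apply: (L2_bound mA mXw (g := fun t => (X t w ^+ 2)%:E)) => //.
- by apply/measurable_EFinP/measurable_funX.
- exact: nearW.
- by move=> t _; rewrite lee_fin sqr_ge0.
- by move: Nw; rewrite fin_numElt => /andP[].
Qed.

Definition kernel_coef (u : T2 -> R) (w : T1) : R :=
  \int[m2]_(t in A) (X t w * u t).

Let mres (u : V2) : measurable_fun [set: T2] (u \_ A).
Proof.
have [mu _] := (L2P m2 mA u).1 (L2vecP u).
exact/(measurable_restrictT _ mA).1.
Qed.

Let kernel_coefE u w :
  kernel_coef u w = fine (\int[m2]_t (Z (w, t) * (u \_ A) t)%:E)%E.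
Proof.
rewrite /kernel_coef /Rintegral integral_mkcond; congr fine.
apply: eq_integral => t _; rewrite !patchE ZE.
by case: ifPn => // _; rewrite mul0r.
Qed.

Let measurable_kernel_coef (u : V2) : measurable_fun [set: T1] (kernel_coef u).
Proof.
rewrite (_ : kernel_coef u =
  fun w => fine (\int[m2]_t (Z (w, t) * (u \_ A) t)%:E)%E); last first.
  by apply/funext => w; exact: kernel_coefE.
apply: measurableT_comp; first exact: fine_measurable.
apply: (measurable_partial_integral1 m2 (f := fun z => (Z z * (u \_ A) z.2)%:E)).
apply/measurable_EFinP; apply: measurable_funM => //.
by apply: measurableT_comp => //; exact: mres.
Qed.

Let ae_kernel_coef_dot (u : V2) : {ae m1, forall w, exists2 x : V2,
  (x : T2 -> R) = (fun t => X t w) & kernel_coef u w = dot2 x u /\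
  Nint w = (dot2 x x)%:E}.
Proof.
apply: filterS ae_section_L2 => w Lw; exists (L2Vec Lw) => //; split => //.
exact: (L2_nsqE mA Lw).
Qed.

Let ae_kernel_coef_bound (u : V2) : {ae m1, forall w, setT w ->
  ((kernel_coef u w ^+ 2)%:E <= (dot2 u u)%:E * Nint w)%E}.
Proof.
apply: filterS (ae_kernel_coef_dot u) => w [x _ [-> ->]] _.
by rewrite -EFinM lee_fin mulrC (cauchy_schwarz (L2_dotP m2 mA)).
Qed.

Let int_bound (u : V2) :
  (\int[m1]_w ((dot2 u u)%:E * Nint w) = (kernel_nsq * dot2 u u)%:E)%E.
Proof.
rewrite ge0_integralZl//; last by rewrite lee_fin (dot_ge0 (L2_dotP m2 mA)).
by rewrite int_Nint -EFinM mulrC.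
Qed.

Lemma kernel_coef_L2 (u : V2) : kernel_coef u \in L2pred m1 [set: T1].
Proof.
apply: (@L2_bound _ _ _ m1 _ measurableT _ (fun w => (dot2 u u)%:E * Nint w)%E) => //.
- exact: measurable_funeM.
- by move=> w _; rewrite mule_ge0// lee_fin (dot_ge0 (L2_dotP m2 mA)).
- by rewrite int_bound ltry.
Qed.

Definition kernel_op (u : V2) : V1 := L2Vec (kernel_coef_L2 u).

Lemma kernel_op_bounded (u : V2) :
  dot1 (kernel_op u) (kernel_op u) <= kernel_nsq * dot2 u u.
Proof.
rewrite -lee_fin /= -(L2_nsqE measurableT (L2vecP (kernel_op u))) -int_bound.
apply: ae_ge0_le_integral => //.
- by move=> w _; rewrite lee_fin sqr_ge0.
- by apply/measurable_EFinP/measurable_funX/measurable_kernel_coef.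
- by move=> w _; rewrite mule_ge0// lee_fin (dot_ge0 (L2_dotP m2 mA)).
- exact: measurable_funeM.
- exact: ae_kernel_coef_bound.
Qed.

(** For almost every w, [kernel_op (f k) w] is the k-th coordinate of the section at w, so Parseval
    sums the squares to [Nint w]; the nonnegative series is integrated termwise. *)
Lemma kernel_op_trace (f : nat -> V2) : parseval_basis dot2 f ->
  \sum_(k < n) dot1 (kernel_op (f k)) (kernel_op (f k)) @[n --> \oo] --> kernel_nsq.
Proof.
move=> fB.
have sumE : (\sum_(0 <= k <oo) (dot1 (kernel_op (f k)) (kernel_op (f k)))%:E
    = kernel_nsq%:E)%E.
  under eq_eseriesr => k _.
    rewrite -(L2_nsqE measurableT (L2vecP (kernel_op (f k)))); over.
  rewrite -integral_nneseries//; last 2 first.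
    - by move=> k; apply/measurable_EFinP/measurable_funX/measurable_kernel_coef.
    - by move=> k w _; rewrite lee_fin sqr_ge0.
  rewrite -int_Nint; apply: ge0_ae_eq_integral => //.
  - apply: ge0_emeasurable_sum => [k w _ _|k _]; first by rewrite lee_fin sqr_ge0.
    by apply/measurable_EFinP/measurable_funX/measurable_kernel_coef.
  - by move=> w _; apply: nneseries_ge0 => k _ _; rewrite lee_fin sqr_ge0.
  - apply: filterS ae_section_L2 => w Lw _.
    rewrite /Nint (L2_nsqE mA Lw).
    apply: cvg_lim => //.
    have -> : (fun n => \sum_(0 <= k < n) ((kernel_op (f k) w ^+ 2)%:E))%E =
        EFin \o (fun n => \sum_(k < n) dot2 (L2Vec Lw) (f k) ^+ 2).
      by apply/funext => n /=; rewrite sumEFin big_mkord.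
    by apply: cvg_EFin; [exact: nearW|exact: fB.2].
pose a n := \sum_(k < n) dot1 (kernel_op (f k)) (kernel_op (f k)).
have : (\sum_(0 <= k < n) (dot1 (kernel_op (f k)) (kernel_op (f k)))%:E)%E
    @[n --> \oo] --> kernel_nsq%:E.
  rewrite -sumE; apply: is_cvg_nneseries => k _ _.
  by rewrite lee_fin (dot_ge0 (L2_dotP m1 measurableT)).
have -> : (fun n => \sum_(0 <= k < n) (dot1 (kernel_op (f k)) (kernel_op (f k)))%:E)%E
    = EFin \o a.
  by apply/funext => n; rewrite /a /= sumEFin big_mkord.
by move=> /fine_cvgP[_]; apply.
Qed.

Let adj (Y : V1) (t : T2) := L2_dot m1 [set: T1] Y (X t).

Let mZY (Y : V1) : measurable_fun [set: T1 * T2] (fun z => (Y z.1 * Z z)%:E).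
Proof.
apply/measurable_EFinP; apply: measurable_funM => //.
apply: measurableT_comp => //.
by have [] := (L2P m1 measurableT Y).1 (L2vecP Y).
Qed.

Let adj_L2 (Y : V1) : adj Y \in L2pred m2 A.
Proof.
have madj : measurable_fun A (adj Y).
  apply: (@eq_measurable_fun _ _ _ _ _
    (fun t => fine (\int[m1]_w (Y w * Z (w, t))%:E)%E)).
    by move=> t tA /=; congr fine; apply: eq_integral => w _; rewrite ZE tA.
  apply: measurable_funTS; apply: measurableT_comp; first exact: fine_measurable.
  exact: (measurable_partial_integral2 m1 (mZY Y)).
apply: (@L2_bound _ _ _ m2 _ mA _
  (fun t => (dot1 Y Y)%:E * (L2_dot m1 [set: T1] (X t) (X t))%:E)%E) => //.
- by apply: measurable_funeM; apply/measurable_EFinP/measurable_nsq_section.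
- apply: nearW => t At; rewrite -EFinM lee_fin.
  exact: (cauchy_schwarz (L2_dotP m1 measurableT) Y (L2Vec (XL2 At))).
- move=> t At; rewrite -EFinM lee_fin mulr_ge0//.
    exact: (dot_ge0 (L2_dotP m1 measurableT)).
  exact: (dot_ge0 (L2_dotP m1 measurableT) (L2Vec (XL2 At))).
- rewrite ge0_integralZl//.
  + by rewrite integral_nsq_section -EFinM ltry.
  + by apply/measurable_EFinP/measurable_nsq_section.
  + move=> t At; rewrite lee_fin.
    exact: (dot_ge0 (L2_dotP m1 measurableT) (L2Vec (XL2 At))).
  + by rewrite lee_fin (dot_ge0 (L2_dotP m1 measurableT)).
Qed.

Definition kernel_adj (Y : V1) : V2 := L2Vec (adj_L2 Y).

Lemma kernel_adjE (Y : V1) t : kernel_adj Y t = L2_dot m1 [set: T1] Y (X t).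
Proof. by []. Qed.

(** Makes the integrand of [kernel_adjoint] a product of two square integrable functions on the
    product space, as Fubini requires. *)
Let tensor_L2 (Y : V1) (u : V2) :
  L2 (m1 \x m2)%E [set: T1 * T2] (fun z => Y z.1 * (u \_ A) z.2).
Proof.
have [mY _] := (L2P m1 measurableT Y).1 (L2vecP Y).
have mYu : measurable_fun [set: T1 * T2] (fun z => Y z.1 * (u \_ A) z.2).
  apply: measurable_funM; first exact: measurableT_comp.
  by apply: measurableT_comp => //; exact: mres.
apply/(L2P _ measurableT); split => //.
apply/(integrable12ltyP m1 m2); first by apply/measurable_EFinP/measurable_funX.
rewrite (eq_integral (fun w => (Y w ^+ 2)%:E * (dot2 u u)%:E)%E) => [|w _].
  rewrite ge0_integralZr//.
  - by rewrite (L2_nsqE measurableT (L2vecP Y)) -EFinM ltry.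
  - by apply/measurable_EFinP/measurable_funX.
  - by move=> w _; rewrite lee_fin sqr_ge0.
  - by rewrite lee_fin (dot_ge0 (L2_dotP m2 mA)).
rewrite -(L2_nsqE mA (L2vecP u)) [in RHS]integral_mkcond -ge0_integralZl//.
- apply: eq_integral => t _ /=; rewrite !patchE ger0_norm ?sqr_ge0// exprMn EFinM.
  by case: ifPn => // _; rewrite expr0n.
- apply/(measurable_restrictT _ mA).1.
  apply/measurable_EFinP/measurable_funX.
  by have [] := (L2P m2 mA u).1 (L2vecP u).
- by move=> t _; rewrite patchE; case: ifPn => // _; rewrite lee_fin sqr_ge0.
- by rewrite lee_fin sqr_ge0.
Qed.

Lemma kernel_adjoint (Y : V1) (u : V2) :
  dot1 Y (kernel_op u) = dot2 (kernel_adj Y) u.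
Proof.
pose h z := (Z z * (Y z.1 * (u \_ A) z.2))%:E.
have ih : (m1 \x m2)%E.-integrable [set: T1 * T2] h.
  apply: (L2_mul_integrable measurableT _ (tensor_L2 Y u)).
  by rewrite /L2 patch_setT; exact: L2X.
have [mY _] := (L2P m1 measurableT Y).1 (L2vecP Y).
rewrite /L2_dot /Rintegral.
(* The integrands are compared only where the section is square integrable: elsewhere [fine] could
   turn an infinite inner integral into 0. *)
have -> : (\int[m1]_w (Y w * kernel_op u w)%:E = \int[m1]_w \int[m2]_t h (w, t))%E.
  apply: ae_eq_integral => //.
  - by apply/measurable_EFinP; apply: measurable_funM => //; exact: measurable_kernel_coef.
  - exact: (measurable_fubini_F ih).
  - apply: filterS ae_section_L2 => w Lw _.
    have iw := L2_mul_integrable mA Lw (L2vecP u).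
    rewrite EFinM /= /kernel_coef /Rintegral fineK; last exact: integrable_fin_num.
    rewrite -integralZl// integral_mkcond; apply: eq_integral => t _.
    rewrite /h /= ZE !patchE; case: ifPn => _; last by rewrite mul0r.
    by rewrite -EFinM mulrCA.
rewrite (Fubini ih); congr fine.
rewrite [in RHS]integral_mkcond; apply: eq_integral => t _.
rewrite /h patchE; case: ifPn => tA; last first.
  by rewrite integral0_eq// => w _; rewrite ZE (negPf tA) mul0r.
have At : A t by rewrite inE in tA.
have it := L2_mul_integrable measurableT (L2vecP Y) (XL2 At).
rewrite EFinM /= /adj /L2_dot /Rintegral fineK; last exact: integrable_fin_num.
rewrite -integralZr//; apply: eq_integral => w _.
by rewrite ZE patchE tA -EFinM; congr EFin; ring.
Qed.

End square_integrable_kernel.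

(** * Diagonalisation of K and the expansion at each point *)

Section kernel_spectral.
Context (d1 d2 : measure_display) (T1 : measurableType d1)
  (T2 : measurableType d2) (R : realType).
Variables (m1 : {sigma_finite_measure set T1 -> \bar R})
  (m2 : {sigma_finite_measure set T2 -> \bar R}).
Variables (A : set T2) (X : T2 -> T1 -> R).
Hypothesis mA : measurable A.
Hypothesis L2X : L2 (m1 \x m2)%E ([set: T1] `*` A) (fun z => X z.2 z.1).
Hypothesis XL2 : forall t, A t -> L2 m1 [set: T1] (X t).
Local Notation V1 := (L2vec m1 [set: T1]).
Local Notation V2 := (L2vec m2 A).
Local Notation dot1 := (fun f g : V1 => L2_dot m1 [set: T1] f g).
Local Notation dot2 := (fun f g : V2 => L2_dot m2 A f g).
Local Notation xi := (kernel_op mA L2X).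
Local Notation adj := (kernel_adj mA L2X XL2).
Local Notation K := (fun u : V2 => adj (xi u)).
Local Notation trace := (kernel_nsq m1 m2 A X).

Let dP1 : semi_inner dot1 := L2_dotP m1 measurableT.
Let dP2 : semi_inner dot2 := L2_dotP m2 mA.

Let dotK u v : dot2 (K u) v = dot1 (xi u) (xi v).
Proof. exact: (esym (kernel_adjoint mA L2X XL2 (xi u) v)). Qed.

(** [kernel_op] is linear only up to a null set, so linearity in u is read off after passing to the
    adjoint, where u is a bare argument of [dot2]. *)
Let KP : semi_inner (fun u v => dot2 (K u) v).
Proof.
split=> [u v|u v w|a u v|u].
- by rewrite !dotK (dotC dP1).
- rewrite !dotK !(dotC dP1 _ (xi w)) !(kernel_adjoint mA L2X XL2).
  exact: (dotDr dP2).
- rewrite !dotK !(dotC dP1 _ (xi v)) !(kernel_adjoint mA L2X XL2).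
  exact: (dotZr dP2).
- by rewrite dotK (dot_ge0 dP1).
Qed.

Let adj_null Y u v : dot2 (u - v) (u - v) = 0 -> dot1 Y (xi u) = dot1 Y (xi v).
Proof.
move=> uv; rewrite [LHS](kernel_adjoint mA L2X XL2 Y u).
rewrite [RHS](kernel_adjoint mA L2X XL2 Y v) !(dotC dP2 (adj Y)).
exact: (dot_null_eql dP2).
Qed.

Lemma kernel_eigenbasis : countably_total dot2 -> infinite_dim dot2 ->
  exists (e : nat -> V2) (lam : nat -> R), [/\ parseval_basis dot2 e,
    forall i, 0 <= lam i & forall i t, A t -> K (e i) t = lam i * e i t].
Proof.
move=> sep inf.
have compl : dot_complete dot2 := @riesz_fischer _ _ _ m2 A mA.
have [f fB] := parseval_basis_exists dP2 compl sep inf.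
have Kb u : dot2 (K u) u <= trace * dot2 u u by rewrite dotK kernel_op_bounded.
have Kt n : \sum_(k < n) dot2 (K (f k)) (f k) <= trace.
  under eq_bigr do rewrite dotK.
  have tr := kernel_op_trace mA L2X fB.
  rewrite -(cvg_lim _ tr)//.
  apply: (nondecreasing_cvgn_le (u_ := fun n => \sum_(k < n) dot1 (xi (f k)) (xi (f k)))).
    apply/nondecreasing_seqP => k.
    rewrite big_ord_recr lerDl; exact: (dot_ge0 dP1 (xi (f k))).
  by apply/cvg_ex; exists trace.
have Kc : compact_form dot2 K := trace_class_compact_form dP2 KP fB Kb Kt.
have [e0 [lam [e0B lam0 Ke0]]] := compact_eigenbasis dP2 compl sep inf KP Kc.
(* Only the representative changes, as [ee0] shows; the gain is an eigenvalue equation at every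
   point of A. *)
pose e i := if lam i == 0 then e0 i else (lam i)^-1 *: K (e0 i).
have ee0 i : dot2 (e i - e0 i) (e i - e0 i) = 0.
  rewrite /e; case: eqVneq => [_|lN]; first by rewrite subrr (dot0l dP2).
  have -> : (lam i)^-1 *: K (e0 i) - e0 i =
      (lam i)^-1 *: (K (e0 i) - lam i *: e0 i).
    by rewrite scalerBr scalerA mulVf// scale1r.
  by rewrite (nsqZ dP2) Ke0 mulr0.
have eB := parseval_basis_null dP2 e0B ee0.
exists e, lam; split=> // i t At.
(* K u s is the product of [xi u] with X s, so its value at each single point depends only on the
   class of u. *)
have Ke u v s : A s -> dot2 (u - v) (u - v) = 0 -> K u s = K v s.
  move=> As uv; rewrite !kernel_adjE.
  have := adj_null (L2Vec (XL2 As)) uv.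
  by rewrite !(dotC dP1 (L2Vec (XL2 As))).
rewrite [LHS](Ke _ _ _ At (ee0 i)) /e; case: eqVneq => [l0|lN]; last first.
  by rewrite L2valZ mulrA divff// mul1r.
(* For eigenvalue 0, nsq of [xi (e0 i)] equals dot2 (K (e0 i)) (e0 i) = 0, so K (e0 i) vanishes at
   every point. *)
rewrite l0 mul0r kernel_adjE.
suff h : dot1 (xi (e0 i)) (xi (e0 i)) = 0.
  exact: (dot_null_l dP1 (L2Vec (XL2 At)) h).
rewrite -dotK; have := Ke0 i; rewrite l0 scale0r subr0.
exact: (dot_null_l dP2).
Qed.

Variables (e : nat -> V2) (lam : nat -> R).
Hypothesis eB : parseval_basis dot2 e.
Hypothesis eE : forall i t, A t -> K (e i) t = lam i * e i t.

Lemma kernel_op_eigenE i j : dot1 (xi (e i)) (xi (e j)) = (i == j)%:R * lam j.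
Proof.
rewrite -[LHS]dotK; transitivity (dot2 (lam i *: e i) (e j)).
  by apply: eq_Rintegral => t; rewrite inE => At; rewrite eE.
by rewrite (dotZl dP2) eB.1 mulrC; case: eqVneq => [->//|_]; rewrite !mul0r.
Qed.

Let XV t (At : A t) : V1 := L2Vec (XL2 At).

Let dotX t (At : A t) i : dot1 (XV At) (xi (e i)) = lam i * e i t.
Proof. by rewrite [LHS](dotC dP1) -eE. Qed.

(** The function g_n of the overview in its second form, which needs no proof of [A t] and so can be
    integrated. *)
Let G n t := L2_dot m1 [set: T1] (X t) (X t) - \sum_(0 <= i < n) lam i * e i t ^+ 2.

Let GE n t (At : A t) :
  G n t = dot1 (XV At - \sum_(0 <= i < n) e i t *: xi (e i))
               (XV At - \sum_(0 <= i < n) e i t *: xi (e i)).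
Proof.
rewrite [RHS](@pythagoras _ _ _ dP1 _ (index_iota 0 n) (fun i => xi (e i)) lam
  (fun i => e i t) (XV At)) ?iota_uniq//.
by move=> i j _ _; exact: kernel_op_eigenE.
Qed.

Let G_ge0 n t : A t -> 0 <= G n t.
Proof. by move=> At; rewrite (GE n At) (dot_ge0 dP1). Qed.

Hypothesis lam_ge0 : forall i, 0 <= lam i.

(** The residual at t is the residual at s plus X_t - X_s minus the projection of X_t - X_s on the
    first n coefficients. By [pythagoras] this last difference is no longer than X_t - X_s, whence a
    bound uniform in n. *)
Let G_dist n t s (At : A t) (As : A s) :
  G n t <= 2 * G n s + 2 * dot1 (XV At - XV As) (XV At - XV As).
Proof.
rewrite (GE n At) (GE n As).
set St := \sum_(_ <- _) _; set Ss := \sum_(_ <- _) _.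
have -> : XV At - St = (XV As - Ss) + (XV At - XV As - (St - Ss)).
  by rewrite opprB addrACA addKr [XV As + _]addrC subrK.
rewrite (le_trans (nsqD_le dP1 _ _))// lerD2l ler_pM2l//.
have -> : St - Ss = \sum_(0 <= i < n) (e i t - e i s) *: xi (e i).
  by rewrite -sumrB; apply: eq_bigr => i _; rewrite scalerBl.
rewrite [leLHS](@pythagoras _ _ _ dP1 _ (index_iota 0 n) (fun i => xi (e i)) lam
  (fun i => e i t - e i s) (XV At - XV As)) ?iota_uniq//.
- rewrite gerBl; apply: sumr_ge0 => i _; rewrite mulr_ge0// sqr_ge0//.
- by move=> i j _ _; exact: kernel_op_eigenE.
- by move=> i _; rewrite [LHS](dotBl dP1) !dotX mulrBr.
Qed.

Let integral_G n : m2.-integrable A (EFin \o G n) /\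
  (\int[m2]_(t in A) (G n t)%:E = (trace - \sum_(0 <= i < n) lam i)%:E)%E.
Proof.
elim: n => [|n [iG GE']].
  have -> : G 0 = fun t => L2_dot m1 [set: T1] (X t) (X t).
    by apply/funext => t; rewrite /G big_geq// subr0.
  rewrite big_geq// subr0 -(integral_nsq_section L2X XL2); split=> //.
  apply/integrableP; split.
    exact/measurable_EFinP/(measurable_nsq_section L2X).
  rewrite (eq_integral (fun t => (L2_dot m1 [set: T1] (X t) (X t))%:E)) => [|t].
    by rewrite (integral_nsq_section L2X XL2) ltry.
  rewrite inE => At; rewrite gee0_abs// lee_fin.
  exact: (dot_ge0 dP1 (XV At)).
have ie : m2.-integrable A (EFin \o (fun t => lam n * (e n t * e n t))).
  rewrite (_ : EFin \o _ = (fun t => (lam n)%:E * (e n t * e n t)%:E)%E)//.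
  by apply: integrableZl => //; exact: (L2_mul_integrable mA (L2vecP _) (L2vecP _)).
have GS : G n.+1 = fun t => G n t - lam n * (e n t * e n t).
  by apply/funext => t; rewrite /G big_nat_recr//= opprD addrA -expr2.
split.
  rewrite GS (_ : EFin \o _ =
    ((EFin \o G n) \- (EFin \o (fun t => lam n * (e n t * e n t))%R))%E)//.
  exact: integrableB.
rewrite GS (integralB_EFin mA iG ie) GE'.
have -> : (\int[m2]_(t in A) (lam n * (e n t * e n t))%:E = (lam n)%:E)%E.
  under eq_integral do rewrite EFinM.
  rewrite integralZl//; last exact: (L2_mul_integrable mA (L2vecP _) (L2vecP _)).
  under eq_integral do rewrite -expr2.
  by rewrite (L2_nsqE mA (L2vecP (e n))) (eB.1 n n) eqxx mule1.
by rewrite -EFinB big_nat_recr//= opprD addrA.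
Qed.

(* Averaging [G_dist] over a small set near t bounds G_n(t) by the tail of
   the trace. *)
Lemma kernel_expansion t (At : A t) :
  (forall eps : R, 0 < eps -> exists S, [/\ measurable S, S `<=` A,
     (0 < m2 S < +oo)%E &
     forall s (As : A s), S s ->
       dot1 (L2Vec (XL2 At) - L2Vec (XL2 As))
            (L2Vec (XL2 At) - L2Vec (XL2 As)) <= eps]) ->
  dot1 (\sum_(i < n) e i t *: xi (e i) - L2Vec (XL2 At))
       (\sum_(i < n) e i t *: xi (e i) - L2Vec (XL2 At)) @[n --> \oo] --> 0.
Proof.
move=> Hloc.
have -> : (fun n => dot1 (\sum_(i < n) e i t *: xi (e i) - L2Vec (XL2 At))
       (\sum_(i < n) e i t *: xi (e i) - L2Vec (XL2 At))) = G ^~ t.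
  apply/funext => n; rewrite (GE n At) -(nsqN dP1) opprB big_mkord//.
have tr : \sum_(i < n) lam i @[n --> \oo] --> trace.
  have -> : (fun n => \sum_(i < n) lam i) =
      (fun n => \sum_(i < n) dot1 (xi (e i)) (xi (e i))).
    apply/funext => n; apply: eq_bigr => i _.
    by rewrite kernel_op_eigenE eqxx mul1r.
  exact: kernel_op_trace.
apply/cvgrPdist_le => eps eps0.
(* One eps / 4 bounds the oscillation on S, the other the tail of the trace divided by m; then G n t
   / 2 <= eps / 4 + eps / 4. *)
have eps4 : 0 < eps / 4 by rewrite divr_gt0.
have [S [mS SA /andP[S0 Soo] HS]] := Hloc _ eps4.
pose m := fine (m2 S).
have mE : (m2 : {measure set T2 -> \bar R}) S = m%:E by rewrite fineK// ge0_fin_numE.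
have m0 : 0 < m by rewrite -lte_fin -mE.
have meps : 0 < m * (eps / 4) by rewrite mulr_gt0.
have /cvgrPdist_le/(_ _ meps) := tr.
apply: filterS => n /= Hn.
have tail : trace - \sum_(0 <= i < n) lam i <= m * (eps / 4).
  by rewrite big_mkord; exact: le_trans (ler_norm _) Hn.
rewrite sub0r normrN ger0_norm ?G_ge0//.
have low s : S s -> G n t / 2 - eps / 4 <= G n s.
  move=> Ss; have As := SA _ Ss.
  have := G_dist n At As; have := HS s As Ss.
  by move: (G n t) (G n s) (L2_dot _ _ _ _) => x y z; lra.
have avg : m * (G n t / 2 - eps / 4) <= trace - \sum_(0 <= i < n) lam i.
  rewrite -lee_fin; have [iG <-] := integral_G n.
  apply: (@le_trans _ _ (\int[m2]_(s in S) (G n s)%:E)%E).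
    have -> : (m * (G n t / 2 - eps / 4))%:E =
        (\int[m2]_(s in S) (G n t / 2 - eps / 4)%:E)%E.
      by rewrite integral_cst// mE EFinM muleC.
    have iGS : m2.-integrable S (EFin \o G n) by exact: integrableS iG.
    apply: le_integral => //; last by move=> s; rewrite inE => Ss; rewrite lee_fin low.
    apply/integrableP; split; first exact: measurable_cst.
    by rewrite integral_cst// mE ltry.
  apply: ge0_subset_integral => //; first by case/integrableP: iG.
  by move=> s As; rewrite lee_fin G_ge0.
have := le_trans avg tail; rewrite ler_pM2l//.
by move: (G n t) => x; lra.
Qed.

End kernel_spectral.
(** * Mean-square continuous processes *)

Section mean_square.
Context (R : realType) (d : measure_display) (Omega : measurableType d).
Variables (P : probability Omega R) (D : set R) (X : R -> Omega -> R).
Local Notation mu := (@lebesgue_measure R).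
Hypothesis mD : measurable D.
Hypothesis suppD : locally_nonnull D.
Hypothesis procX : stochastic_process D X.
Hypothesis msX : mean_square_continuous P D X.
Hypothesis L2X : square_integrable_process P D X.

Lemma mean_square_ball t : D t -> forall eps : R, 0 < eps ->
  exists2 r : R, 0 < r &
  forall s, D s -> ball t r s ->
    (\int[P]_w ((X s w - X t w) ^+ 2)%:E <= eps%:E)%E.
Proof.
move=> Dt eps eps0.
have nb : nbhs (0%E : \bar R) [set y | (y < eps%:E)%E].
  by apply: open_nbhs_nbhs; split; [exact: open_ereal_lt_ereal|rewrite /= lte_fin].
have /nbhs_ballP[r /= r0 Hr] := msX Dt nb.
exists r => // s Ds ts.
have [->|st] := eqVneq s t.
  rewrite integral0_eq ?lee_fin ?(ltW eps0)// => w _.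
  by rewrite subrr expr0n.
have := Hr (s - t); rewrite /= subrKC => /(_ _ _ Ds) H.
have {H} : ('E_P[fun w => ((X s w - X t w) ^+ 2)%R] < eps%:E)%E.
  apply: H; last by rewrite subr_eq0.
  by move: ts; rewrite /ball/= sub0r opprB.
by rewrite unlock => /ltW.
Qed.

Let dist_L2 s t : D s -> D t ->
  (\int[P]_w ((X s w - X t w) ^+ 2)%:E < +oo)%E ->
  L2 P [set: Omega] (fun w => X s w - X t w).
Proof.
move=> Ds Dt fin; have mst : measurable_fun [set: Omega] (fun w => X s w - X t w).
  by apply: measurable_funB; exact: procX.
apply: (@L2_bound _ _ _ P _ measurableT _ (fun w => ((X s w - X t w) ^+ 2)%:E)) => //.
- by apply/measurable_EFinP/measurable_funX.
- exact: nearW.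
- by move=> w _; rewrite lee_fin sqr_ge0.
Qed.

(** Fubini gives X_s in L^2 only for almost every s. Since D has positive measure near t, some such
    s lies close enough to t for X_s - X_t to be in L^2, and X_t is the difference of the two. *)
Lemma mean_square_L2 t : D t -> L2 P [set: Omega] (X t).
Proof.
move=> Dt; have [r r0 Hr] := mean_square_ball Dt ltr01.
have [s [Ds ts Ls]] : exists s, [/\ D s, ball t r s & L2 P [set: Omega] (X s)].
  apply: contrapT => H.
  have ae2 := ae_integrable2 (Lfun2_integrable_sqr L2X).
  have : mu.-negligible (D `&` ball t r).
    apply: negligibleS ae2 => s [Ds ts] /= iZ; apply: H; exists s; split => //.
    apply/(L2P P measurableT); split; first exact: procX.
    move: iZ; congr (_.-integrable _ _); apply/funext => w /=.
    by rewrite patchE in_setX in_setT mem_set.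
  move=> /(@measure_negligible _ _ _ mu _ (measurableI _ _ mD (measurable_ball t r))) h.
  by have := suppD Dt r0; rewrite h ltxx.
have Lst : L2 P [set: Omega] (fun w => X s w - X t w).
  by apply: dist_L2 => //; apply: le_lt_trans (Hr s Ds ts) _; rewrite ltry.
have := L2vecP (L2Vec Ls - L2Vec Lst).
by rewrite (_ : L2val _ = X t)//; apply/funext => w; exact: subKr.
Qed.

Lemma mean_square_nsq t (Dt : D t) (eps : R) : 0 < eps ->
  exists S : set R, [/\ measurable S, S `<=` D, (0 < mu S < +oo)%E &
    forall s (Ds : D s), S s ->
      L2_dot P [set: Omega] (L2Vec (mean_square_L2 Dt) - L2Vec (mean_square_L2 Ds))
        (L2Vec (mean_square_L2 Dt) - L2Vec (mean_square_L2 Ds)) <= eps].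
Proof.
move=> eps0; have [r r0 Hr] := mean_square_ball Dt eps0.
have mB : measurable (D `&` ball t r) by apply: measurableI => //; exact: measurable_ball.
exists (D `&` ball t r); split.
- exact: mB.
- exact: subIsetl.
- apply/andP; split; first exact: suppD.
  apply: (@le_lt_trans _ _ (mu (ball t r))).
    apply: le_measure; rewrite ?inE; [exact: mB|exact: measurable_ball|].
    exact: subIsetr.
  by rewrite lebesgue_measure_ball ?ltry// ltW.
- move=> s Ds [_ ts].
  rewrite -lee_fin -(L2_nsqE measurableT (L2vecP _)) (le_trans _ (Hr s Ds ts))//.
  rewrite le_eqVlt; apply/orP; left; apply/eqP/eq_integral => w _.
  by congr EFin; rewrite -sqrrN opprB.
Qed.

End mean_square.
Theorem theorem5p3 (R : realType) (d : measure_display)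
    (Omega : measurableType d) (P : probability Omega R)
    (D : set R) (X : R -> Omega -> R)
    (mD : measurable D) (D0 : D !=set0) (suppD : locally_nonnull D)
    (procX : stochastic_process D X)
    (cX : centered P D X)
    (msX : mean_square_continuous P D X)
    (L2X : square_integrable_process P D X) :
  exists (e : nat -> R -> R) (lam : nat -> R),
    let x := fun i => process_coef D X (e i) in
    [/\ orthonormal_basis lebesgue_measure D e,
        forall i, 0 <= lam i /\
          eigenvector lebesgue_measure D (autocorrelation_operator P D X)
            (lam i) (e i),
        forall t, D t ->
          L2_cvg P [set: Omega] (fun n w => \sum_(i < n) x i w * e i t) (X t),
        forall i, 'E_P[x i]%E = 0%E &
        (forall i j, 'E_P[fun w => (x i w * x j w)%R]%E
                     = ((i == j)%:R * lam j)%:E) /\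
        (forall i, 'V_P[x i]%E = (lam i)%:E)].
Proof.
pose XL2 := mean_square_L2 mD suppD procX msX L2X.
have [e [lam [eB lam0 eE]]] := @kernel_eigenbasis _ _ _ _ R P
  lebesgue_measure D X mD L2X XL2
  (lebesgue_L2_countably_total mD) (lebesgue_L2_infinite_dim mD D0 suppD).
pose xi := @kernel_op _ _ _ _ R P lebesgue_measure D X mD L2X.
pose adjE := @kernel_adjoint _ _ _ _ R P lebesgue_measure D X mD L2X XL2.
have dPP := L2_dotP P (@measurableT _ Omega).
have xE i : process_coef D X (e i) = xi (e i) :> (Omega -> R) by [].
have EE (u v : L2vec P [set: Omega]) :
    'E_P[fun w => (u w * v w)%R]%E = (L2_dot P [set: Omega] u v)%:E.
  rewrite unlock /L2_dot /Rintegral fineK//.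
  exact: (integrable_fin_num _ (L2_mul_integrable measurableT (L2vecP u) (L2vecP v))).
have L1 : L2 P [set: Omega] (cst 1 : Omega -> R).
  by rewrite -indicT; apply: L2_indic => //;
    exact: (le_lt_trans (probability_le1 P measurableT) (ltry 1)).
(* E[x_i] is the product of the constant 1 with [xi (e i)]; by adjointness it is the integral of
   E[X_t] e_i(t) over D, and E[X_t] = 0. *)
have Ex0 i : 'E_P[process_coef D X (e i)]%E = 0%E.
  rewrite xE -[RHS]/((0 : R)%:E).
  have := EE (L2Vec L1) (xi (e i)).
  have -> : (fun w => L2Vec L1 w * xi (e i) w) = xi (e i) :> (Omega -> R).
    by apply/funext => w; rewrite /= mul1r.
  move=> ->; congr EFin.
  rewrite [LHS](adjE (L2Vec L1) (e i)).
  rewrite /L2_dot (eq_Rintegral lebesgue_measure (g := fun=> 0)) => [|t].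
    by rewrite /Rintegral integral0.
  rewrite inE => Dt; rewrite kernel_adjE /L2_dot /Rintegral.
  rewrite (eq_integral (fun w => (X t w)%:E)) => [|w _]; last by rewrite /= mul1r.
  by have := cX t Dt; rewrite unlock => ->; rewrite mul0r.
exists e, lam => x; split.
- exact: (@parseval_orthonormal_basis _ _ _ lebesgue_measure D mD _ eB).
- move=> i; split=> //; split; first exact: L2vecP.
    move=> /(@L2_dot_ae0 _ _ _ lebesgue_measure D mD _ (L2vecP (e i))) e0.
    have := eB.1 i i; rewrite /= e0 eqxx.
    by move/eqP; rewrite eq_sym oner_eq0.
  apply: nearW => s Ds; rewrite -eE//.
  (* Adjointness with Y = X_s rewrites the product of x_i and X_s as the integral of E[X_s X_t]
     e_i(t), which is the autocorrelation operator. *)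
  apply: (etrans _ (dotC dPP (L2Vec (XL2 s Ds)) (xi (e i)))).
  apply: (etrans _ (esym (adjE (L2Vec (XL2 s Ds)) (e i)))).
  apply: eq_Rintegral => t; rewrite inE => Dt.
  by rewrite kernel_adjE /autocorrelation unlock.
- move=> t Dt.
  have := @kernel_expansion _ _ _ _ R P lebesgue_measure D X mD L2X XL2
    e lam eB eE lam0 t Dt
    (mean_square_nsq mD suppD procX msX L2X Dt).
  move=> /(L2_cvg_nsq measurableT); congr (L2_cvg _ _ _ _).
  apply/funext => n; apply/funext => w; rewrite L2val_sum.
  by apply: eq_bigr => i _; rewrite mulrC.
- exact: Ex0.
- have Exx i j : 'E_P[fun w => (x i w * x j w)%R]%E = ((i == j)%:R * lam j)%:E.
    rewrite (EE (xi (e i)) (xi (e j))); congr EFin.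
    exact: (@kernel_op_eigenE _ _ _ _ R P lebesgue_measure D X mD L2X XL2 e lam eB eE).
  split=> // i.
  rewrite /variance covariance.unlock Ex0 -[in RHS](mul1r (lam i)).
  have := Exx i i; rewrite eqxx => <-; congr ('E_P[_])%E.
  by apply/funext => w; rewrite /= ?fctE /= subr0.
Qed.
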